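(* Let $\Bbbk=\mathbb{C}$, $n\ge1$ and $d_1,d_2\ge1$. Let $M$ be the space of representations $\{A_i\in\mathrm{Mat}_{d_2\times d_1}(\mathbb{C}),\,B_i\in\mathrm{Mat}_{d_1\times d_2}(\mathbb{C})\mid 1\le i\le n\}$ of $\overline{\Gamma}_n$ of dimension $(d_1,d_2)$ on which the Euler continuants $(A_1,B_1,\dots,A_n,B_n)$ and $(B_n,A_n,\dots,B_1,A_1)$ are invertible, identified with the fission variety $\mathcal{B}^{n+1}(\mathbb{C}^{d_1},\mathbb{C}^{d_2})$. Let $\mathrm{P}_{\mathrm{Rep}}$ and $\omega_{\mathrm{Rep}}$ be the matrix bivector and matrix $2$-form induced on $M$ by the noncommutative bivector $\mathrm{P}_n$ of the double quasi-Poisson bracket of $\mathcal{B}(\Gamma_n)$ and by the noncommutative $2$-form $$\omega_n=\tfrac12(b_n,\ldots,a_1)^{-1}\mathrm{D}^2(b_n,\ldots,a_1)-\tfrac12(a_1,\ldots,b_n)^{-1}\mathrm{D}^2(a_1,\ldots,b_n),$$ respectively. Then the $2$-form $\mathrm{tr}(\omega_{\mathrm{Rep}})$ is the $2$-form of Boalch's quasi-Hamiltonian structure on $M\simeq\mathcal{B}^{n+1}(\mathbb{C}^{d_1},\mathbb{C}^{d_2})$. Furthermore, $\mathrm{tr}(\omega_{\mathrm{Rep}})$ corresponds to the quasi-Poisson bivector $\mathrm{tr}(\mathrm{P}_{\mathrm{Rep}})$.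
   Context: Euler continuants are given by $(y_1)=y_1$, $(y_1,y_2)=y_1y_2+1$ (with $1$ the identity of the appropriate size), $(y_1,\dots,y_k)=(y_1,\dots,y_{k-1})y_k+(y_1,\dots,y_{k-2})$. The notation $(a_1,\dots,b_n)$ stands for $(a_1,b_1,\dots,a_n,b_n)$ and $(b_n,\dots,a_1)$ for $(b_n,a_n,\dots,b_1,a_1)$; similarly for matrices. The algebra $\mathcal{B}(\Gamma_n)$ is generated by orthogonal idempotents $e_1,e_2$ with $e_1+e_2=1$ and $a_i=e_2a_ie_1$, $b_i=e_1b_ie_2$ ($1\le i\le n$), with these two continuants inverted (in them, $1$ is replaced by the appropriate idempotent $e_2$ or $e_1$). The group $H=\mathrm{GL}_{d_1}(\mathbb{C})\times\mathrm{GL}_{d_2}(\mathbb{C})$ acts on $M$ by $(g_1,g_2)\cdot(A_i,B_i)=(g_2A_ig_1^{-1},g_1B_ig_2^{-1})$, and the moment map is $\mu=\big((B_n,\dots,A_1)^{-1},(A_1,\dots,B_n)\big):M\to H$. The $2$-form: $\mathrm{D}^2$ is the linear operation on noncommutative polynomials sending a monomial $c_1\cdots c_m$ to $\sum_{k<k'}c_1\cdots c_{k-1}(dc_k)c_{k+1}\cdots c_{k'-1}(dc_{k'})c_{k'+1}\cdots c_m$. Replacing $a_i,b_i$ by the matrix functions $A_i,B_i$ (and using wedge products of matrix-valued $1$-forms) gives $$\mathrm{tr}(\omega_{\mathrm{Rep}})=\tfrac12\mathrm{tr}\big((B_n,\ldots,A_1)^{-1}\mathrm{D}^2(B_n,\ldots,A_1)\big)-\tfrac12\mathrm{tr}\big((A_1,\ldots,B_n)^{-1}\mathrm{D}^2(A_1,\ldots,B_n)\big).$$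 The bivector: the double bracket of $\mathcal{B}(\Gamma_n)$ is the double bracket (a bilinear map $\{\!\!\{x,y\}\!\!\}=\{\!\!\{x,y\}\!\!\}'\otimes\{\!\!\{x,y\}\!\!\}''$ to $\mathcal{B}(\Gamma_n)^{\otimes2}$ with $\{\!\!\{x,y\}\!\!\}=-\tau_{(12)}\{\!\!\{y,x\}\!\!\}$, a derivation in $y$ for the outer bimodule structure, zero on $e_1,e_2$) determined, with $\mathrm{sgn}(0)=0$, by $\{\!\!\{a_i,a_j\}\!\!\}=\frac12\mathrm{sgn}(i-j)(a_i\otimes a_j+a_j\otimes a_i)$, $\{\!\!\{b_i,b_j\}\!\!\}=\frac12\mathrm{sgn}(i-j)(b_i\otimes b_j+b_j\otimes b_i)$, and $\{\!\!\{a_i,b_j\}\!\!\}$ equal to $\frac12(e_1\otimes a_ib_j+b_ja_i\otimes e_2)$ if $i<j$, $\frac12(e_1\otimes a_ib_i+b_ia_i\otimes e_2)+e_1\otimes e_2$ if $i=j$, $-\frac12(e_1\otimes a_ib_j+b_ja_i\otimes e_2)-\delta_{i-j,1}e_1\otimes e_2$ if $i>j$. The bivector $\mathrm{tr}(\mathrm{P}_{\mathrm{Rep}})$ is the bivector field $P$ on $M$ whose bracket $\{f,g\}=P(df,dg)$ on matrix entries is $\{X_{ij},Y_{kl}\}=\{\!\!\{x,y\}\!\!\}'_{kj}\{\!\!\{x,y\}\!\!\}''_{il}$, where $X$ is the matrix function representing $x\in\mathcal{B}(\Gamma_n)$. Boalch's $2$-form: put $\mathrm{b}_\ell=A_{(2n-\ell+2)/2}$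 for $\ell$ even and $\mathrm{b}_\ell=B_{(2n-\ell+1)/2}$ for $\ell$ odd, $1\le\ell\le2n$. In these coordinates on $\mathcal{B}^{n+1}(\mathbb{C}^{d_1},\mathbb{C}^{d_2})$, Boalch's quasi-Hamiltonian $2$-form, in the explicit form due to Paluba and normalised to have moment map $\mu$, is $\frac12\mathrm{tr}\big((\mathrm{b}_1,\ldots,\mathrm{b}_{2n})^{-1}\mathrm{D}^2(\mathrm{b}_1,\ldots,\mathrm{b}_{2n})\big)-\frac12\mathrm{tr}\big((\mathrm{b}_{2n},\ldots,\mathrm{b}_1)^{-1}\mathrm{D}^2(\mathrm{b}_{2n},\ldots,\mathrm{b}_1)\big)$. (In Paluba's convention the moment map is $\mu^{-1}$ and the $2$-form is the negative of this one.) Correspondence (Alekseev--Kosmann-Schwarzbach--Meinrenken): a $2$-form $\omega$ and a quasi-Poisson bivector $P$ on $M$ with moment map $\mu$ correspond to each other if $$P^\sharp\circ\omega^\flat=\mathrm{Id}_{TM}-\tfrac14\sum_a(e_a)_M\otimes\mu^*(\theta^L_a-\theta^R_a),$$ where $\omega^\flat(v)=\omega(v,\cdot)$, $P^\sharp(\alpha)=P(\alpha,\cdot)$, $(e_a)$ is an orthonormal basis of $\mathrm{Lie}(H)$ for the trace form, $\xi_M(m)=\frac{d}{dt}\big|_{t=0}\exp(-t\xi)\cdot m$, and $\theta^L_a,\theta^R_a$ are the components of the left and right Maurer--Cartan forms $h^{-1}dh$, $dh\,h^{-1}$. *)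

(* Defs.v *)
From HB Require Import structures.
From mathcomp Require Import all_boot all_order all_algebra.
From mathcomp Require Import finmap complex.
From mathcomp Require Import all_classical all_reals all_analysis.
(* The notations of monalg clash with those of mathcomp-analysis. *)
From mathcomp Require Import -(notations) monalg.

Set Implicit Arguments.
Unset Strict Implicit.
Unset Printing Implicit Defensive.

Import Order.TTheory GRing.Theory Num.Theory.
Import numFieldNormedType.Exports.

Local Open Scope ring_scope.
Local Open Scope complex_scope.

(* [continuant_rev e [:: y_k; ...; y_1]] is (y_1, ..., y_k), with e for 1. *)
Fixpoint continuant_rev (S : pzRingType) (e : S) (s : seq S) : S :=
  match s with
  | [::] => e
  | [:: y] => y
  | y :: ((_ :: s2) as s1) => continuant_rev e s1 * y + continuant_rev e s2
  end.

Definition continuant (S : pzRingType) (e : S) (s : seq S) : S :=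
  continuant_rev e (rev s).

(* x_1, y_1, ..., x_n, y_n *)
Definition interleave (S : Type) (n : nat) (x y : 'I_n -> S) : seq S :=
  flatten [seq [:: x i; y i] | i <- enum 'I_n].

Section NoncommutativeForms.
Variables (K : fieldType) (L : choiceType).

(* Noncommutative polynomials in the letters L, and noncommutative
   differential forms on them: the free algebra on the letters c = inl c and
   dc = inr c. *)
Definition ncpoly := malg (fmonom L) K.
Definition ncform := malg (fmonom (L + L)%type) K.

Definition ncvar (c : L) : ncpoly := mkmalgU (fmu c) 1.

Definition D2_word (w : seq L) : ncform :=
  \sum_(k < size w) \sum_(k' < size w | (k < k')%N)
     mkmalgU (FMonom [seq if (p.1 == val k) || (p.1 == val k')
                          then inr p.2 else inl p.2
                     | p <- zip (iota 0 (size w)) w]) 1.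

Definition D2 (p : ncpoly) : ncform :=
  \sum_(w <- msupp p) mcoeff w p *: D2_word (fmonom_val w).

End NoncommutativeForms.

Section Calculus.
Variable R : realType.
Local Notation C := R[i].

(* C^o is C as a normed module over itself, which carries the topology. *)
Definition mx_derive (p q : nat) (F : C -> 'M[C]_(p, q)) (t0 : C) :
    'M[C]_(p, q) :=
  \matrix_(i, j) derive1 (fun t : C^o => F t i j : C^o) t0.

Definition mx_diff (V : lmodType C) (p q : nat) (F : V -> 'M[C]_(p, q))
    (m v : V) : 'M[C]_(p, q) :=
  mx_derive (fun t => F (m + t *: v)) 0.

Definition diff_fun (V : vectType C) (f : V -> C) (m : V) : 'Hom(V, C^o) :=
  linfun (fun v => derive1 (fun t : C^o => f (m + (t : C) *: v) : C^o) 0).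

Definition expmx (d : nat) (X : 'M[C]_d) : 'M[C]_d :=
  \matrix_(i, j)
    limn (series (fun k => (k`!%:R)^-1 * (X ^+ k) i j : C^o)).

Section FormEvaluation.
Variables (V : lmodType C) (L : choiceType) (N : nat).
Variable rho : L -> V -> 'M[C]_N.

(* The word w with c replaced by rho c and the successive dc by the values of
   d(rho c) at the successive tangent vectors vs; 0 if the degree of w is not
   the length of vs. *)
Fixpoint word_eval (w : seq (L + L)) (m : V) (vs : seq V) : 'M[C]_N :=
  match w, vs with
  | [::], [::] => 1
  | inl c :: w', _ => rho c m * word_eval w' m vs
  | inr c :: w', v :: vs' => mx_diff (rho c) m v * word_eval w' m vs'
  | _, _ => 0
  end.

(* Wedge product: (alpha /\ beta)(u, v)
   = alpha(u) beta(v) - alpha(v) beta(u). *)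
Definition form2_eval (eta : ncform C L) (m u v : V) : 'M[C]_N :=
  \sum_(w <- msupp eta) mcoeff w eta *:
    (word_eval (fmonom_val w) m [:: u; v]
     - word_eval (fmonom_val w) m [:: v; u]).

End FormEvaluation.
End Calculus.

(* Representations of dimension (d1, d2): m.1 i is A_i, m.2 i is B_i. *)
Notation rep_space R n d1 d2 :=
  ({ffun 'I_n -> 'M[R[i]%C]_(d2, d1)} * {ffun 'I_n -> 'M[R[i]%C]_(d1, d2)})%type.

(* The Lie algebra of H, in which H is the open subset of invertible pairs. *)
Notation lieH R d1 d2 := ('M[R[i]%C]_d1 * 'M[R[i]%C]_d2)%type.

Section Representations.
Variables (R : realType) (n d1 d2 : nat).
Local Notation C := R[i].
Local Notation V := (rep_space R n d1 d2).

(* Matrices between C^d1 and C^d2 are embedded as blocks in End(C^d1 + C^d2),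
   where 1 restricts to the identity of each summand: the (2,2)-block of
   (A_1, ..., B_n) and the (1,1)-block of (B_n, ..., A_1) computed in
   End(C^d1 + C^d2) are the continuants of the rectangular matrices. *)
Definition Amx (i : 'I_n) (m : V) : 'M[C]_(d1 + d2) :=
  block_mx 0 0 (m.1 i) 0.
Definition Bmx (i : 'I_n) (m : V) : 'M[C]_(d1 + d2) :=
  block_mx 0 (m.2 i) 0 0.

Definition contAB (m : V) : 'M[C]_d2 :=
  drsubmx (continuant 1 (interleave (Amx^~ m) (Bmx^~ m))).
Definition contBA (m : V) : 'M[C]_d1 :=
  ulsubmx (continuant 1 (rev (interleave (Amx^~ m) (Bmx^~ m)))).

Definition inM (m : V) : bool :=
  (contAB m \in unitmx) && (contBA m \in unitmx).

(* The letters a_i = inl i and b_i = inr i. *)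
Definition arrow_mx (c : 'I_n + 'I_n) (m : V) : 'M[C]_(d1 + d2) :=
  match c with inl i => Amx i m | inr i => Bmx i m end.

Definition arrow_word : seq (ncpoly C ('I_n + 'I_n)%type) :=
  interleave (fun i => ncvar C (inl i : 'I_n + 'I_n)%type)
             (fun i => ncvar C (inr i : 'I_n + 'I_n)%type).

Definition tr_omega_Rep (m u v : V) : C :=
  2^-1 * \tr (invmx (contBA m) *m
    ulsubmx (form2_eval arrow_mx (D2 (continuant 1 (rev arrow_word))) m u v))
  - 2^-1 * \tr (invmx (contAB m) *m
    drsubmx (form2_eval arrow_mx (D2 (continuant 1 arrow_word)) m u v)).

(* A_k and B_k for 1 <= k <= n. *)
Definition Anat (k : nat) (m : V) : 'M[C]_(d1 + d2) :=
  if insub k.-1 is Some i then Amx i m else 0.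
Definition Bnat (k : nat) (m : V) : 'M[C]_(d1 + d2) :=
  if insub k.-1 is Some i then Bmx i m else 0.

(* The coordinates b_l (1 <= l <= 2n) of the fission variety. *)
Definition fission_mx (l : nat) (m : V) : 'M[C]_(d1 + d2) :=
  if odd l then Bnat (n.*2 - l + 1)./2 m else Anat (n.*2 - l + 2)./2 m.

Definition fission_word : seq (ncpoly C nat) :=
  [seq ncvar C l | l <- iota 1 n.*2].

(* As b_1 = B_n and b_2n = A_1, the continuant (b_1, ..., b_2n) is an
   endomorphism of C^d1, and (b_2n, ..., b_1) one of C^d2. *)
Definition boalch_form (m u v : V) : C :=
  let b := [seq fission_mx l m | l <- iota 1 n.*2] in
  2^-1 * \tr (invmx (ulsubmx (continuant 1 b)) *m
    ulsubmx (form2_eval fission_mx (D2 (continuant 1 fission_word)) m u v))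
  - 2^-1 * \tr (invmx (drsubmx (continuant 1 (rev b))) *m
    drsubmx (form2_eval fission_mx (D2 (continuant 1 (rev fission_word)))
      m u v)).

Local Notation h := (lieH R d1 d2).

Definition act (g : h) (m : V) : V :=
  ([ffun i => g.2 *m m.1 i *m invmx g.1],
   [ffun i => g.1 *m m.2 i *m invmx g.2]).

Definition exp_flow (xi : h) (m : V) (t : C) : V :=
  act (expmx (- t *: xi.1), expmx (- t *: xi.2)) m.

Definition fundamental_field (xi : h) (m : V) : V :=
  ([ffun i => mx_derive (fun t => (exp_flow xi m t).1 i) 0],
   [ffun i => mx_derive (fun t => (exp_flow xi m t).2 i) 0]).

Definition moment (m : V) : h := (invmx (contBA m), contAB m).

Definition dmoment (m v : V) : h :=
  (mx_diff (fun x => (moment x).1) m v, mx_diff (fun x => (moment x).2) m v).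

(* Pullbacks by the moment map of h^-1 dh and dh h^-1. *)
Definition mu_thetaL (m v : V) : h :=
  (invmx (moment m).1 *m (dmoment m v).1,
   invmx (moment m).2 *m (dmoment m v).2).
Definition mu_thetaR (m v : V) : h :=
  ((dmoment m v).1 *m invmx (moment m).1,
   (dmoment m v).2 *m invmx (moment m).2).

Definition trace_form (x y : h) : C :=
  \tr (x.1 *m y.1) + \tr (x.2 *m y.2).

Definition orthonormal_basis (N : nat) (e : N.-tuple h) : Prop :=
  basis_of {:h} e /\
  forall a b : 'I_N, trace_form (tnth e a) (tnth e b) = (a == b)%:R.

(* M is open in V, so its tangent spaces are V and its cotangent spaces are
   the dual of V. *)
Definition is_bivector (P : V -> 'Hom(V, C^o) -> 'Hom(V, C^o) -> C) : Prop :=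
  forall m, inM m ->
    (forall al be, P m al be = - P m be al) /\
    (forall (c : C) al be ga,
       P m (c *: al + be) ga = c * P m al ga + P m be ga).

Definition flat (om : V -> V -> V -> C) (m v : V) : 'Hom(V, C^o) :=
  linfun (fun w => om m v w : C^o).

(* The vector w is P^#(al) = P(al, -), under V = V^**. *)
Definition is_sharp (P : V -> 'Hom(V, C^o) -> 'Hom(V, C^o) -> C)
    (m : V) (al : 'Hom(V, C^o)) (w : V) : Prop :=
  forall be : 'Hom(V, C^o), P m al be = be w.

Definition corresponds (om : V -> V -> V -> C)
    (P : V -> 'Hom(V, C^o) -> 'Hom(V, C^o) -> C) : Prop :=
  forall (N : nat) (e : N.-tuple h), orthonormal_basis e ->
  forall m, inM m -> forall v,
    is_sharp P m (flat om m v)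
      (v - 4^-1 *: \sum_(a < N)
         (coord e a (mu_thetaL m v) - coord e a (mu_thetaR m v))
           *: fundamental_field (tnth e a) m).

End Representations.

Section DoubleBracket.
Variables (K : fieldType) (n : nat).

Definition corner_invertible (B : pzRingType) (e x : B) : Prop :=
  exists u : B, [/\ u = e * u * e, x * u = e & u * x = e].

Definition gamma_relations (B : algType K) (e1 e2 : B) (a b : 'I_n -> B) :
    Prop :=
  [/\ [/\ e1 * e1 = e1, e2 * e2 = e2, e1 * e2 = 0, e2 * e1 = 0
        & e1 + e2 = 1],
      forall i, a i = e2 * a i * e1,
      forall i, b i = e1 * b i * e2,
      corner_invertible e2 (continuant e2 (interleave a b))
    & corner_invertible e1 (continuant e1 (rev (interleave a b)))].

(* B is the algebra B(Gamma_n): it is universal with these generators,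
   relations and inverses. *)
Definition is_BGamma (B : algType K) (e1 e2 : B) (a b : 'I_n -> B) : Prop :=
  gamma_relations e1 e2 a b /\
  forall (B' : algType K) (e1' e2' : B') (a' b' : 'I_n -> B'),
    gamma_relations e1' e2' a' b' ->
    let extends (f : {lrmorphism B -> B'}) :=
      [/\ f e1 = e1', f e2 = e2', forall i, f (a i) = a' i
        & forall i, f (b i) = b' i] in
    exists f : {lrmorphism B -> B'},
      extends f /\ forall g : {lrmorphism B -> B'}, extends g -> g =1 f.

Definition is_bilinear (U W : lmodType K) (f : U -> U -> W) : Prop :=
  (forall y, linear (f ^~ y)) /\ (forall x, linear (f x)).

(* (T, tens) is the tensor square of U. *)
Definition is_tensor_square (U T : lmodType K) (tens : U -> U -> T) : Prop :=
  is_bilinear tens /\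
  forall (W : lmodType K) (f : U -> U -> W), is_bilinear f ->
    exists g : {linear T -> W},
      (forall x y, g (tens x y) = f x y) /\
      forall g' : {linear T -> W},
        (forall x y, g' (tens x y) = f x y) -> g' =1 g.

Section Bracket.
Variables (B : algType K) (T : lmodType K) (tens : B -> B -> T).
Variable dbr : B -> B -> T.

Definition tens_sum (s : seq (B * B)) : T := \sum_(p <- s) tens p.1 p.2.

(* Equations between elements x' (x) x'' of the tensor square are stated for
   all their expressions as sums of pure tensors. *)
Definition is_double_bracket (e1 e2 : B) : Prop :=
  [/\ is_bilinear dbr,
      forall x y s, dbr y x = tens_sum s ->
        dbr x y = - tens_sum [seq (p.2, p.1) | p <- s],
      forall x y z s t, dbr x y = tens_sum s -> dbr x z = tens_sum t ->
        dbr x (y * z) = tens_sum [seq (y * p.1, p.2) | p <- t]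
                        + tens_sum [seq (p.1, p.2 * z) | p <- s]
    & forall x, [/\ dbr x e1 = 0, dbr x e2 = 0, dbr e1 x = 0
                  & dbr e2 x = 0]].

Definition gamma_bracket_values (e1 e2 : B) (a b : 'I_n -> B) : Prop :=
  let sgn (i j : 'I_n) : K :=
    if (i < j)%N then -1 else if i == j then 0 else 1 in
  [/\ forall i j, dbr (a i) (a j) =
        (2^-1 * sgn i j) *: (tens (a i) (a j) + tens (a j) (a i)),
      forall i j, dbr (b i) (b j) =
        (2^-1 * sgn i j) *: (tens (b i) (b j) + tens (b j) (b i))
    & forall i j,
        let t := 2^-1 *: (tens e1 (a i * b j) + tens (b j * a i) e2) in
        dbr (a i) (b j) =
          if (i < j)%N then t
          else if i == j then t + tens e1 e2
          else - t - ((i - j)%N == 1%N)%:R *: tens e1 e2].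

End Bracket.
End DoubleBracket.

Section InducedBivector.
Variables (R : realType) (n d1 d2 : nat).
Local Notation C := R[i].
Local Notation V := (rep_space R n d1 d2).
Variable B : algType C.

(* X is the algebra morphism B -> End(C^d1 + C^d2) given by the
   representation m. *)
Definition is_representation (e1 e2 : B) (a b : 'I_n -> B) (m : V)
    (X : B -> 'M[C]_(d1 + d2)) : Prop :=
  [/\ linear X, {morph X : x y / x * y}, X 1 = 1,
      X e1 = block_mx 1%:M 0 0 0 /\ X e2 = block_mx 0 0 0 1%:M
    & forall i, X (a i) = Amx i m /\ X (b i) = Bmx i m].

Definition induces_bivector (T : lmodType C) (tens dbr : B -> B -> T)
    (X : V -> B -> 'M[C]_(d1 + d2))
    (P : V -> 'Hom(V, C^o) -> 'Hom(V, C^o) -> C) : Prop :=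
  forall m, inM m -> forall x y s, dbr x y = tens_sum tens s ->
  forall i j k l : 'I_(d1 + d2),
    P m (diff_fun (fun m' => X m' x i j) m)
        (diff_fun (fun m' => X m' y k l) m)
    = \sum_(p <- s) X m p.1 k j * X m p.2 i l.

End InducedBivector.

(* Main.v *)
(** In the algebra of endomorphisms of C^d1 + C^d2, put y_{2i-1} = A_i and
    y_{2i} = B_i and let g = (1 + y_1) ... (1 + y_2n).  As the letters alternate
    between the two off-diagonal blocks, the two continuants are diagonal
    corners of g and of g^-1.  In the triangular factorisation
    g = (1 + p) h (1 + q), the block diagonal part h is the moment map, so with
    y_0 = - p and y_{2n+1} = - q the product of all the 1 + y_l is h, and the
    2-form is - 1/2 tr (h^-1 D^2 h), with D^2 taken over the letters
    y_0, ..., y_{2n+1}.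

    The double bracket says that, with Q = [Z, y_k] / 2, the Hamiltonian vector
    field of tr (Z y_k) is
      y_l |-> sgn (l - k) [Q, y_l] + (if l = k + 1 then Z else 0)
                                   - (if l = k - 1 then Z else 0).
    After conjugation of each letter by the product of the preceding ones these
    variations telescope, and their contraction with tr (h^-1 D^2 h) is
    2 tr (Z dy_k) + tr (Q (dh h^-1 - h^-1 dh)).  Since the fundamental vector
    fields act on the letters by commutators, this is the correspondence.

    Boalch's coordinates are the same letters in the reverse order. *)
Require Import Defs.
From HB Require Import structures.
From mathcomp Require Import all_boot all_order all_algebra perm zify ring.
From mathcomp Require Import finmap complex.
From mathcomp Require Import all_classical all_reals all_analysis.
From mathcomp Require Import -(notations) monalg.

Set Implicit Arguments.
Unset Strict Implicit.
Unset Printing Implicit Defensive.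

Import Order.TTheory GRing.Theory Num.Theory.
Import numFieldNormedType.Exports.

Local Open Scope ring_scope.
Local Open Scope complex_scope.

(** * Ordered products of unipotent factors and their variations *)

Section OrderedProducts.
Variable S : pzRingType.
Implicit Types (y u v : nat -> S) (l N : nat).

(** The corner identities are proved over an arbitrary ring with two complementary idempotents and
    then used a second time over the ring of triangular matrices [jet x u v w]. There the top entry
    of a product collects the terms with the variation u to the left of v, which is what D^2
    evaluates, so the identities pass to D^2 without being differentiated.

    The added letters y_0 and y_{2n+1} depend on the others, so a tangent vector has to be extended
    to them in such a way that the product stays block diagonal to first order. For a Hamiltonian
    variation nothing has to be solved: the same formula applied to all 2n+2 letters changes h by -
    (Q + h Q h^-1) h, which is block diagonal.

    Both sides of the correspondence are linear in a covector, so it is tested on matrix entries tr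
    (Z y_k) with Z a matrix unit. The coefficient 1/4 is the product of the 1/2 in the 2-form and
    the 1/2 in Q. *)

Fixpoint pprod y l : S := if l is l'.+1 then pprod y l' * (1 + y l') else 1.

Fixpoint rprod y l : S := if l is l'.+1 then (1 + y l') * rprod y l' else 1.

Fixpoint dpprod y u l : S :=
  if l is l'.+1 then dpprod y u l' * (1 + y l') + pprod y l' * u l' else 0.

Fixpoint drprod y u l : S :=
  if l is l'.+1 then u l' * rprod y l' + (1 + y l') * drprod y u l' else 0.

(** Only the terms with [u] to the left of [v] are kept; the wedge product antisymmetrises them
    later, in [pw_form]. *)
Fixpoint d2pprod y u v l : S :=
  if l is l'.+1 then d2pprod y u v l' * (1 + y l') + dpprod y u l' * v l'
  else 0.

Lemma pprodSl y l : pprod y l.+1 = (1 + y 0%N) * pprod (fun j => y j.+1) l.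
Proof.
elim: l => [|l IHl]; first by rewrite /= mul1r mulr1.
by rewrite -[LHS]/(pprod y l.+1 * _) IHl mulrA.
Qed.

Lemma rprodSr y l : rprod y l.+1 = rprod (fun j => y j.+1) l * (1 + y 0%N).
Proof.
elim: l => [|l IHl]; first by rewrite /= mul1r mulr1.
by rewrite -[LHS]/(_ * rprod y l.+1) IHl mulrA.
Qed.

Lemma dpprodSl y u l :
  dpprod y u l.+1 = u 0%N * pprod (fun j => y j.+1) l
    + (1 + y 0%N) * dpprod (fun j => y j.+1) (fun j => u j.+1) l.
Proof.
elim: l => [|l IHl]; first by rewrite /= mul0r mul1r mulr1 mulr0 addr0 add0r.
have -> : dpprod y u l.+2 =
    dpprod y u l.+1 * (1 + y l.+1) + pprod y l.+1 * u l.+1 by [].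
rewrite IHl pprodSl /=; set P := pprod _ _; set D := dpprod _ _ _.
by rewrite (mulrDl (u 0%N * P)) (mulrDr (1 + y 0%N) (D * _)) !mulrA addrA.
Qed.

Lemma eq_pprod y y' l :
  (forall j, (j < l)%N -> y j = y' j) -> pprod y l = pprod y' l.
Proof.
elim: l => //= l IHl yE; rewrite yE // IHl // => j jl.
exact/yE/ltnW.
Qed.

Lemma eq_rprod y y' l :
  (forall j, (j < l)%N -> y j = y' j) -> rprod y l = rprod y' l.
Proof.
elim: l => //= l IHl yE; rewrite yE // IHl // => j jl.
exact/yE/ltnW.
Qed.

Lemma eq_dpprod y u y' u' l : (forall j, (j < l)%N -> y j = y' j) ->
  (forall j, (j < l)%N -> u j = u' j) -> dpprod y u l = dpprod y' u' l.
Proof.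
elim: l => //= l IHl yE uE.
have yE' j : (j < l)%N -> y j = y' j by move=> jl; apply/yE/ltnW.
rewrite yE // uE // IHl ?(eq_pprod yE') // => j jl.
exact/uE/ltnW.
Qed.

Section Inverse.
Variable y : nat -> S.
Hypothesis ysq0 : forall l, y l * y l = 0.

Definition iprod l : S := rprod (fun j => - y j) l.

Lemma unipotentV l : (1 + y l) * (1 - y l) = 1.
Proof. by rewrite mulrDl !mulrBr ysq0 !mul1r !mulr1 subr0 subrK. Qed.

Lemma unipotentVl l : (1 - y l) * (1 + y l) = 1.
Proof. by rewrite mulrBl !mulrDr ysq0 !mul1r !mulr1 addr0 addrK. Qed.

Lemma pprodV l : pprod y l * iprod l = 1.
Proof.
rewrite /iprod; elim: l => [|l IHl] /=; first by rewrite mulr1.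
by rewrite mulrA -(mulrA (pprod _ _)) unipotentV mulr1.
Qed.

Lemma pprodVl l : iprod l * pprod y l = 1.
Proof.
rewrite /iprod; elim: l => [|l IHl] /=; first by rewrite mulr1.
by rewrite mulrA -(mulrA (1 - y l)) IHl mulr1 unipotentVl.
Qed.

Definition pconj l (x : S) : S := pprod y l * x * iprod l.

Lemma pconjD l : {morph pconj l : a b / a + b}.
Proof. by move=> a b; rewrite /pconj mulrDr mulrDl. Qed.

Lemma pconjB l : {morph pconj l : a b / a - b}.
Proof. by move=> a b; rewrite /pconj mulrBr mulrBl. Qed.

Lemma pconjN l : {morph pconj l : a / - a}.
Proof. by move=> a; rewrite /pconj mulrN mulNr. Qed.

Lemma pconjM l a b : pconj l a * pconj l b = pconj l (a * b).
Proof.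
rewrite /pconj -!mulrA (mulrA (iprod l)) pprodVl mul1r.
by rewrite !mulrA.
Qed.

Lemma pconjS l x : pconj l.+1 x = pconj l ((1 + y l) * x * (1 - y l)).
Proof. by rewrite /pconj /iprod /= !mulrA. Qed.

Lemma pconj0 x : pconj 0 x = x.
Proof. by rewrite /pconj /iprod /= mulr1 mul1r. Qed.

(** Logarithmic derivative of the product: [1 - y l] inverts the factor that varies, and the factors
    after it cancel, which leaves a conjugate by the factors before it. *)
Lemma dpprod_pconj u N :
  dpprod y u N * iprod N = \sum_(l < N) pconj l (u l * (1 - y l)).
Proof.
elim: N => [|N IHN]; first by rewrite big_ord0 mul0r.
rewrite big_ord_recr /= -IHN /iprod /= mulrDl; congr (_ + _).
  by rewrite -mulrA (mulrA (1 + _)) unipotentV mul1r.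
by rewrite /pconj /iprod !mulrA.
Qed.

Lemma d2pprod_pconj u v N :
  d2pprod y u v N * iprod N =
  \sum_(l < N) (\sum_(j < l) pconj j (u j * (1 - y j)))
               * pconj l (v l * (1 - y l)).
Proof.
elim: N => [|N IHN]; first by rewrite big_ord0 mul0r.
rewrite big_ord_recr /= -IHN -dpprod_pconj /iprod /= mulrDl; congr (_ + _).
  by rewrite -mulrA (mulrA (1 + _)) unipotentV mul1r.
rewrite /pconj -/(iprod N) -!mulrA (mulrA (iprod N)) pprodVl mul1r.
by rewrite !mulrA.
Qed.

End Inverse.
End OrderedProducts.

(** * Second-order jets as triangular matrices *)

Section Jets.
Variable S : pzRingType.
Implicit Types x u v w a b f g : S.

(* The algebra of these matrices is that of pairs of first-order deformations
   u, v of x together with the mixed second-order term w. *)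
Definition jet (x u v w : S) : 'M[S]_3 :=
  \matrix_(i, j) nth 0 (nth [::] [:: [:: x; u; w]; [:: 0; x; v]; [:: 0; 0; x]]
                            i) j.

Definition jet_top (A : 'M[S]_3) : S := A ord0 ord_max.

Lemma jet_topE x u v w : jet_top (jet x u v w) = w.
Proof. by rewrite /jet_top mxE. Qed.

Lemma jetD x u v w x' u' v' w' :
  jet x u v w + jet x' u' v' w' = jet (x + x') (u + u') (v + v') (w + w').
Proof.
apply/matrixP => i j; rewrite !mxE.
by case: i => [[|[|[|?]]] ?] //=; case: j => [[|[|[|?]]] ?] //=; rewrite addr0.
Qed.

Lemma jetM x u v w x' u' v' w' :
  jet x u v w * jet x' u' v' w' =
  jet (x * x') (x * u' + u * x') (x * v' + v * x')
      (x * w' + u * v' + w * x').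
Proof.
apply/matrixP => i j; rewrite !mxE !big_ord_recl big_ord0 !mxE /=.
case: i => [[|[|[|?]]] ?] //=; case: j => [[|[|[|?]]] ?] //=;
  by rewrite ?mul0r ?mulr0 ?addr0 ?add0r // addrA.
Qed.

Lemma jet1 : jet 1 0 0 0 = 1.
Proof.
apply/matrixP => i j; rewrite !mxE.
by case: i => [[|[|[|?]]] ?] //=; case: j => [[|[|[|?]]] ?] //=.
Qed.

Lemma jet_pprod (y u v : nat -> S) l :
  pprod (fun j => jet (y j) (u j) (v j) 0) l =
  jet (pprod y l) (dpprod y u l) (dpprod y v l) (d2pprod y u v l).
Proof.
elim: l => [|l IHl] /=; first by rewrite jet1.
rewrite IHl -jet1 jetD jetM !add0r mulr0 add0r.
by congr jet; rewrite addrC.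
Qed.

Lemma jet_rprod (y u v : nat -> S) l : exists w,
  rprod (fun j => jet (y j) (u j) (v j) 0) l =
  jet (rprod y l) (drprod y u l) (drprod y v l) w.
Proof.
elim: l => [|l [w IHl]] /=; first by exists 0; rewrite jet1.
by eexists; rewrite IHl -jet1 jetD jetM !add0r addrC (addrC (u l * _)) (addrC
  (v l * _)).
Qed.

(** The right-hand side is an explicit right inverse of [jet f a b w], and a left inverse equals any
    right inverse. Its entries are the first and second variations of the inverse of [f]. *)
Lemma jet_inverse (A : 'M[S]_3) f g a b w :
  f * g = 1 -> A * jet f a b w = 1 ->
  A = jet g (- (g * a * g)) (- (g * b * g))
            (g * a * g * b * g - g * w * g).
Proof.
move=> fg AJ.
have: A * (jet f a b w * jet g (- (g * a * g)) (- (g * b * g))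
            (g * a * g * b * g - g * w * g)) =
  jet g (- (g * a * g)) (- (g * b * g)) (g * a * g * b * g - g * w * g).
  by rewrite mulrA AJ mul1r.
rewrite jetM !mulrN !mulrBr !mulrA fg !mul1r !addNr.
rewrite (addrAC (a * g * b * g)) subrr add0r addNr.
by rewrite jet1 mulr1.
Qed.

End Jets.

(** * Two-block grading and corners of alternating products *)

Section Grading.
Variables (S : pzRingType) (e : bool -> S).

Definition complementary_idempotents : Prop :=
  (forall b, e b * e b = e b) /\ e true + e false = 1.

Definition homog (b c : bool) (x : S) : Prop := e b * x * e c = x.

Definition even_elt (x : S) : Prop := forall b, e b * x = x * e b.

Definition alternating (y : nat -> S) : Prop :=
  forall l, homog (odd l) (~~ odd l) (y l).

Hypothesis eP : complementary_idempotents.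

Lemma idem_sum b : e b + e (~~ b) = 1.
Proof. by case: b; rewrite /= ?(addrC (e false)) eP.2. Qed.

Lemma idemN b : e (~~ b) = 1 - e b.
Proof. by rewrite -(idem_sum b) addrC addKr. Qed.

Lemma idem_orth b : e b * e (~~ b) = 0.
Proof. by rewrite idemN mulrBr mulr1 eP.1 subrr. Qed.

Lemma idem_orthN b : e (~~ b) * e b = 0.
Proof. by rewrite -{2}[b]negbK idem_orth. Qed.

Lemma homog_l b c x : homog b c x -> e b * x = x.
Proof. by move=> xE; rewrite -[x in RHS]xE -[in LHS]xE !mulrA eP.1. Qed.

Lemma homog_r b c x : homog b c x -> x * e c = x.
Proof. by move=> xE; rewrite -[x in RHS]xE -[in LHS]xE -!mulrA eP.1. Qed.

Lemma homog_l0 b c x : homog b c x -> e (~~ b) * x = 0.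
Proof. by move=> /homog_l <-; rewrite mulrA idem_orthN mul0r. Qed.

Lemma homog_r0 b c x : homog b c x -> x * e (~~ c) = 0.
Proof. by move=> /homog_r <-; rewrite -mulrA idem_orth mulr0. Qed.

Lemma homogP b c x : e b * x = x -> x * e c = x -> homog b c x.
Proof. by rewrite /homog => -> ->. Qed.

Lemma homogM b c d x y : homog b c x -> homog c d y -> homog b d (x * y).
Proof.
move=> xh yh; apply: homogP; first by rewrite mulrA (homog_l xh).
by rewrite -mulrA (homog_r yh).
Qed.

Lemma homogD b c x y : homog b c x -> homog b c y -> homog b c (x + y).
Proof. by move=> xh yh; rewrite /homog mulrDr mulrDl xh yh. Qed.

Lemma homogN b c x : homog b c x -> homog b c (- x).
Proof. by move=> xh; rewrite /homog mulrN mulNr xh. Qed.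

Lemma homog0 b c : homog b c 0.
Proof. by rewrite /homog mulr0 mul0r. Qed.

Lemma homogM0 b c d x y : homog b c x -> homog (~~ c) d y -> x * y = 0.
Proof.
move=> /homog_r <- /homog_l <-.
by rewrite mulrA -(mulrA x) idem_orth mulr0 mul0r.
Qed.

Lemma even_eltM x y : even_elt x -> even_elt y -> even_elt (x * y).
Proof. by move=> xe ye b; rewrite mulrA xe -mulrA ye mulrA. Qed.

Lemma even_eltD x y : even_elt x -> even_elt y -> even_elt (x + y).
Proof. by move=> xe ye b; rewrite mulrDr mulrDl xe ye. Qed.

Lemma even_eltN x : even_elt x -> even_elt (- x).
Proof. by move=> xe b; rewrite mulrN mulNr xe. Qed.

Lemma even_eltV x z : x * z = 1 -> z * x = 1 -> even_elt x -> even_elt z.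
Proof.
move=> xz zx xe b.
by rewrite -[LHS]mul1r -zx -!mulrA (mulrA x) -xe -(mulrA (e b)) xz mulr1.
Qed.

Lemma homog_even b x : homog b b x -> even_elt x.
Proof.
move=> xh c; case: (altP (c =P b)) => [->|/negPf neq].
  by rewrite (homog_l xh) (homog_r xh).
have -> : c = ~~ b by case: c b neq {xh} => [] [].
by rewrite (homog_l0 xh) (homog_r0 xh).
Qed.

Lemma even_corners x :
  (forall b, e b * x * e (~~ b) = 0) -> even_elt x.
Proof.
move=> x0 b; rewrite -[LHS]mulr1 -(idem_sum b) mulrDr x0 addr0.
have := x0 (~~ b); rewrite negbK => x0N.
by rewrite -[RHS]mul1r -(idem_sum b) mulrDl !mulrA x0N addr0.
Qed.

Section Alternating.
Variable y : nat -> S.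
Hypothesis yalt : alternating y.

Lemma alternating_sq0 l : y l * y l = 0.
Proof. by apply: homogM0 (yalt l) _; rewrite negbK; apply: yalt. Qed.

(** As [N] is even, [y 0] is killed by [e true] on its left and [y N.+1] by [e true] on its right,
    so this corner does not see letters added at the two ends. *)
Lemma corner_pprod N : ~~ odd N ->
  e true * pprod y N.+2 * e true =
  e true * pprod (fun j => y j.+1) N * e true.
Proof.
move=> No; rewrite pprodSl /= !mulrA (mulrDr (e true) 1) mulr1.
rewrite (homog_l0 (yalt 0)) addr0 -!mulrA; congr (_ * (_ * _)).
rewrite mulrDl mul1r; have := homog_r0 (yalt N.+1).
by rewrite /= (negbTE No) /= => ->; rewrite addr0.
Qed.

(** In the inverse the outer letters change sides, so it is now the other corner that ignores
    them. *)
Lemma corner_iprod N : ~~ odd N ->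
  e false * iprod y N.+2 * e false =
  e false * iprod (fun j => y j.+1) N * e false.
Proof.
move=> No; rewrite /iprod rprodSr /= !mulrA (mulrBr (e false) 1) mulr1.
have := homog_l0 (yalt N.+1); rewrite /= (negbTE No) /= => ->.
rewrite subr0 -!mulrA; congr (_ * (_ * _)).
by rewrite mulrBl mul1r (homog_r0 (yalt 0)) subr0.
Qed.

(** Conjugation by [s], which is 1 on one block and -1 on the other, changes the sign of every
    letter and fixes the diagonal corners. *)
Lemma corner_iprod_rprod b l :
  e b * iprod y l * e b = e b * rprod y l * e b.
Proof.
pose s := e b - e (~~ b).
have ey c d x : homog c (~~ c) x -> (e d - e (~~ d)) * x = - x * (e d - e (~~
  d)).
  move=> xh; case: (altP (d =P c)) => [->|neq].
    rewrite mulrBl mulrBr !mulNr opprK (homog_l xh) (homog_l0 xh).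
    have := homog_r0 xh; rewrite negbK => ->.
    by rewrite (homog_r xh) oppr0 add0r addr0.
  have -> : d = ~~ c by case: d c neq {xh} => [] [].
  rewrite negbK mulrBl mulrBr !mulNr opprK (homog_l xh) (homog_l0 xh).
  have := homog_r0 xh; rewrite negbK => ->.
  by rewrite (homog_r xh) addr0 sub0r.
have sr : s * rprod y l = iprod y l * s.
  rewrite /iprod; elim: l => [|l IHl] /=; first by rewrite mulr1 mul1r.
  rewrite mulrA mulrDr mulr1 (ey _ _ _ (yalt l)) -/s -[X in X + _]mul1r.
  by rewrite -mulrDl -!mulrA IHl.
have es : e b * s = e b by rewrite mulrBr eP.1 idem_orth subr0.
have se : s * e b = e b by rewrite mulrBl eP.1 idem_orthN subr0.
have -> : e b * rprod y l * e b = e b * s * rprod y l * e b by rewrite es.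
by rewrite -(mulrA _ s) sr -!mulrA se.
Qed.

End Alternating.
End Grading.

Section JetGrading.
Variables (S : pzRingType) (e : bool -> S).
Hypothesis eP : complementary_idempotents e.

(** With these idempotents the jets of alternating letters alternate again, so each corner identity
    holds for jets; its components are the identities for the first and second variations. *)
Definition jet_idem (b : bool) : 'M[S]_3 := jet (e b) 0 0 0.

Lemma jet_idemP : complementary_idempotents jet_idem.
Proof.
split=> [b|]; first by rewrite jetM !mul0r !mulr0 !addr0 eP.1.
by rewrite jetD !addr0 eP.2 jet1.
Qed.

Lemma jet_top_idem b (A : 'M[S]_3) c :
  jet_top (jet_idem b * A * jet_idem c) = e b * jet_top A * e c.
Proof.
rewrite /jet_top /jet_idem !mxE !big_ord_recl big_ord0 !mxE /=.
rewrite !big_ord_recl !big_ord0 !mxE /= !mul0r !mulr0 !addr0 !add0r.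
by congr (_ * A _ _ * _); apply/val_inj.
Qed.

Definition jet_mid (A : 'M[S]_3) : S := A ord0 (lift ord0 ord0).

Lemma jet_midE x u v w : jet_mid (jet x u v w) = u.
Proof. by rewrite /jet_mid mxE. Qed.

Lemma jet_mid_idem b (A : 'M[S]_3) c :
  jet_mid (jet_idem b * A * jet_idem c) = e b * jet_mid A * e c.
Proof.
rewrite /jet_mid /jet_idem !mxE !big_ord_recl big_ord0 !mxE /=.
rewrite !big_ord_recl !big_ord0 !mxE /= !mul0r !mulr0 !addr0 !add0r.
by congr (_ * A _ _ * _); apply/val_inj.
Qed.

Lemma jet_homog b c x u v w : homog e b c x -> homog e b c u ->
  homog e b c v -> homog e b c w -> homog jet_idem b c (jet x u v w).
Proof.
rewrite /homog => xh uh vh wh; rewrite /jet_idem !jetM.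
by rewrite !mul0r !mulr0 !addr0 !add0r xh uh vh wh.
Qed.

End JetGrading.

(** * The 2-form of an alternating product and Hamiltonian variations *)

Section ProductForm.
Variables (S : pzRingType) (K : zmodType) (tr : {additive S -> K}).
Hypothesis trC : forall x y, tr (x * y) = tr (y * x).
Variable e : bool -> S.
Hypothesis eP : complementary_idempotents e.
Implicit Types (y u v : nat -> S) (l N : nat).

(** The value on (u, v) of tr (h^-1 D^2 h) for h = [pprod y N]. *)
Definition pw_form y N u v : K :=
  tr (iprod y N * (d2pprod y u v N - d2pprod y v u N)).

Section Letters.
Variable y : nat -> S.
Hypothesis yalt : alternating e y.
Let ysq0 := alternating_sq0 eP yalt.
Local Notation uni x l := (pconj y l (x l * (1 - y l))).

Lemma tr_pconj l x : tr (pconj y l x) = tr x.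
Proof. by rewrite /pconj trC mulrA pprodVl // mul1r. Qed.

(* Conjugating the variation of each letter by the product of the letters before
   it turns the variations of [ham_prefix] into telescoping sums. *)
Lemma pw_form_sum N v (x : nat -> S) :
  let pre l := \sum_(j < l) uni x j in
  pw_form y N v x =
  \sum_(l < N) tr (uni v l * (pre N - pre l.+1 - pre l)).
Proof.
move=> pre; rewrite /pw_form trC mulrBl !d2pprod_pconj //.
elim: N => [|N IHN]; first by rewrite !big_ord0 subrr raddf0.
rewrite !big_ord_recr /= -/(pre N) opprD addrACA raddfD IHN.
rewrite subrr sub0r mulrN raddfN raddfB /=.
rewrite addrA; congr (_ + _); last by rewrite trC.
rewrite mulr_suml raddf_sum -big_split /=; apply: eq_bigr => l _.
rewrite -raddfD -mulrDr; congr (tr (_ * _)).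
have -> : pre N.+1 = pre N + uni x N by rewrite /pre big_ord_recr.
by rewrite (addrAC (pre N) (uni x N)) [RHS]addrAC.
Qed.

Lemma tr_odd_even l x Q : homog e (odd l) (~~ odd l) x -> even_elt e Q ->
  tr (x * Q) = 0.
Proof.
move=> xh Qe; rewrite -(homog_l eP xh) -mulrA trC -mulrA -Qe mulrA.
by have := homog_r0 eP xh; rewrite negbK => ->; rewrite mul0r raddf0.
Qed.


Lemma uni_tr l x (Z : S) : homog e (odd l) (~~ odd l) x ->
  homog e (~~ odd l) (odd l) Z ->
  tr (x * (1 - y l) * Z) = tr (x * Z).
Proof.
move=> xh Zh; rewrite mulrBr mulr1 mulrBl.
have -> : x * y l = 0 by apply: homogM0 xh _; rewrite ?negbK //; apply: yalt.
by rewrite mul0r subr0.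
Qed.

Lemma uni_tr_even l x Q : homog e (odd l) (~~ odd l) x -> even_elt e Q ->
  tr (x * (1 - y l) * Q) = 0.
Proof.
move=> xh Qe; rewrite mulrBr mulr1 mulrBl.
have -> : x * y l = 0 by apply: homogM0 xh _; rewrite ?negbK //; apply: yalt.
by rewrite mul0r subr0; apply: tr_odd_even xh Qe.
Qed.

(** The commutator of q with y_l is its commutator with 1 + y_l; dividing by 1 + y_l on the right
    leaves q minus its conjugate by 1 + y_l. Sums over l therefore telescope. *)
Lemma uni_gauge l q :
  pconj y l ((q * y l - y l * q) * (1 - y l)) = pconj y l q - pconj y l.+1 q.
Proof.
rewrite pconjS -pconjB; congr pconj.
have -> : q * y l - y l * q = q * (1 + y l) - (1 + y l) * q.
  by rewrite mulrDr mulrDl mulr1 mul1r opprD addrACA subrr add0r.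
by rewrite mulrBl -mulrA unipotentV // mulr1.
Qed.

Lemma tr_uni l (x : nat -> S) X :
  tr (uni x l * pconj y l X) = tr (x l * (1 - y l) * X).
Proof. by rewrite pconjM // tr_pconj. Qed.

Lemma tr_uniS l (x : nat -> S) X : homog e (odd l) (~~ odd l) (x l) ->
  tr (uni x l * pconj y l.+1 X) = tr (x l * X).
Proof.
move=> xh; rewrite pconjS tr_uni.
have -> : x l * (1 - y l) * ((1 + y l) * X * (1 - y l)) = x l * X * (1 - y l).
  by rewrite !mulrA -(mulrA (x l)) unipotentVl // mulr1.
rewrite trC mulrA mulrBl mul1r.
have -> : y l * x l = 0.
  by apply: (homogM0 eP (yalt l) (y := x l)); rewrite negbK; apply: xh.
by rewrite subr0.
Qed.

End Letters.

Section Hamiltonian.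
Variable y : nat -> S.
Hypothesis yalt : alternating e y.
Let ysq0 := alternating_sq0 eP yalt.
Local Notation uni x l := (pconj y l (x l * (1 - y l))).
Variables (k : nat) (W Q : S).
Hypotheses (k_gt0 : (0 < k)%N) (Wh : homog e (~~ odd k) (odd k) W).

Hypothesis QE : Q = W * y k - y k * W.

(* The variation of the l-th letter under the Hamiltonian vector field of
   tr ((W + W) y_k). *)
Definition ham l : S :=
  (if (l < k)%N then - (Q * y l - y l * Q)
   else if l == k then 0 else Q * y l - y l * Q)
  + (if l == k.+1 then W + W else 0) - (if l.+1 == k then W + W else 0).

Lemma ham_even : even_elt e Q.
Proof.
rewrite QE; apply: even_eltD.
  exact/(homog_even eP)/(homogM eP Wh)/yalt.
exact/even_eltN/(homog_even eP)/(homogM eP _ Wh)/yalt.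
Qed.

Lemma ham_homog : alternating e ham.
Proof.
move=> l; have yQ : homog e (odd l) (~~ odd l) (Q * y l - y l * Q).
  have Qe := ham_even.
  apply: homogD; last apply: homogN.
    by rewrite /homog mulrA Qe -!mulrA [e _ * (_ * _)]mulrA yalt.
  by rewrite /homog -!mulrA -Qe !mulrA yalt.
apply: homogD; [apply: homogD|apply: homogN].
- case: ifP => _; first exact: homogN.
  by case: ifP => // _; apply: homog0.
- case: eqP => [->|_]; last exact: homog0.
  by rewrite /= negbK; apply: homogD.
- case: eqP => [lk|_]; last exact: homog0.
  have Wh' : homog e (odd l) (~~ odd l) W by move: Wh; rewrite -lk /= negbK.
  exact: homogD.
Qed.

Local Notation Qc l := (pconj y l Q).
Local Notation Zp := (pconj y k.+1 (W + W)).
Local Notation Zm := (pconj y k (W + W)).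

Lemma W_y l : odd l = odd k.+1 -> W * y l = 0 /\ y l * W = 0.
Proof.
move=> lk; have yl := yalt l; split.
  by apply: homogM0 Wh _ => //; move: yl; rewrite lk /= negbK; apply.
by move: yl; rewrite lk /= negbK => yl; apply: homogM0 yl Wh.
Qed.

(** With c = y_k W y_k, conjugation by 1 + y_k takes W to W - Q - c and Q to Q + 2c. This relation
    lets the terms Z at the two neighbours of the letter k compensate the change of sign of sgn (l -
    k). *)
Lemma Zp_Zm : Zp - Zm = - (Qc k + Qc k.+1).
Proof.
rewrite !pconjS -pconjB -pconjD -pconjN; congr pconj.
pose c := y k * W * y k.
have -> : (1 + y k) * (W + W) * (1 - y k) = (W - (Q + c)) + (W - (Q + c)).
  rewrite (mulrDr _ W W) mulrDl.
  suff -> : (1 + y k) * W * (1 - y k) = W - (Q + c) by [].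
  rewrite mulrBr mulr1 mulrDl mul1r.

  by rewrite mulrDl -/c QE !opprD opprK !addrA (addrAC W (y k * W)).
have -> : (1 + y k) * Q * (1 - y k) = Q + c + c.
  rewrite mulrBr mulr1 mulrDl mul1r.
  have -> : y k * Q = c by rewrite QE mulrBr !mulrA ysq0 mul0r subr0.
  congr (_ + _); rewrite mulrDl.
  have -> : c * y k = 0 by rewrite /c -mulrA ysq0 mulr0.
  by rewrite QE addr0 mulrBl -mulrA ysq0 mulr0 sub0r opprK.
rewrite addrACA (addrAC (W + W)) subrr add0r -opprD; congr (- _).
by rewrite addrACA !addrA.
Qed.

(** Below k the commutators telescope from Q. The neighbours of k contribute - [Zm] and [Zp], after
    which the telescoping goes on with the opposite sign. *)
Lemma ham_prefix l :
  \sum_(j < l) uni ham j = - Q +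
    (if (l < k)%N then Qc l else if (l <= k.+1)%N then Qc k - Zm else - Qc l).
Proof.
elim: l => [|l IHl]; first by rewrite big_ord0 k_gt0 pconj0 addNr.
rewrite big_ord_recr /= IHl -addrA; congr (_ + _); rewrite /ham.
have [lk|[lk|[lk|[lk|lk]]]] : ((l.+1 < k) \/ (l.+1 = k) \/ (l = k) \/
    (l = k.+1) \/ (k.+1 < l))%N by lia.
- have -> : (l < k)%N by lia.
  have -> : (l == k.+1) = false by lia.
  have -> : (l.+1 == k) = false by lia.
  rewrite lk addr0 subr0 mulNr pconjN uni_gauge //.
  by rewrite opprB addrC subrK.
- have -> : (l < k)%N by lia.
  have -> : (l == k.+1) = false by lia.
  have -> : (l.+1 < k)%N = false by lia.
  have -> : (l.+1 == k) by lia.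
  have -> : (l.+1 <= k.+1)%N by lia.
  rewrite addr0 mulrBl mulNr pconjB pconjN uni_gauge // opprB.
  rewrite addrA [X in X - _]addrC subrK lk; congr (_ - _).
  have [Wy yW] : W * y l = 0 /\ y l * W = 0 by apply: W_y; rewrite -lk /= negbK.
  rewrite -lk pconjS; congr pconj.
  by rewrite (mulrDl 1) mul1r (mulrDr (y l)) yW !addr0.
- rewrite lk ltnn eqxx leqnSn leqnn.
  have -> : (k == k.+1) = false by lia.
  have -> : (k.+1 == k) = false by lia.
  have -> : (k.+1 < k)%N = false by lia.
  by rewrite subr0 addr0 mul0r (_ : pconj y k 0 = 0) ?addr0 // /pconj mulr0
    mul0r.
- have -> : (l < k)%N = false by lia.
  have -> : (l <= k.+1)%N by lia.
  have -> : (l.+1 < k)%N = false by lia.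
  have -> : (l.+1 <= k.+1)%N = false by lia.
  have -> : (l == k) = false by lia.
  have -> : (l == k.+1) by lia.
  have -> : (l.+1 == k) = false by lia.
  rewrite subr0 mulrDl (pconjD y l) uni_gauge // lk.
  have -> : (W + W) * (1 - y k.+1) = W + W.
    by rewrite mulrBr mulr1 mulrDl (W_y erefl).1 addr0 subr0.
  (* The jump [Zp - Zm] cancels both [Qc k] and [Qc k.+1], so that only - [Qc l.+1] survives. *)
  rewrite -[Zp](subrK Zm) Zp_Zm opprD.
  rewrite (addrACA (Qc k.+1)) (addrCA (Qc k.+1)) subrr addr0.
  by rewrite addrACA subrr add0r addrCA addNr addr0.
- have -> : (l < k)%N = false by lia.
  have -> : (l <= k.+1)%N = false by lia.
  have -> : (l.+1 < k)%N = false by lia.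
  have -> : (l.+1 <= k.+1)%N = false by lia.
  have -> : (l == k) = false by lia.
  have -> : (l == k.+1) = false by lia.
  have -> : (l.+1 == k) = false by lia.
  by rewrite addr0 subr0 uni_gauge // addrA addNr add0r.
Qed.

(** In [pw_form_sum] the conjugates of Q in the prefixes at [l] and [l.+1] pair to zero with v_l,
    because Q is even and v_l is odd. The conjugate of W + W pairs nontrivially only at l = k, where
    it occurs in both prefixes: hence the factor 4. *)
Lemma pw_form_ham N v : (k.+2 <= N)%N -> alternating e v ->
  pw_form y N v ham =
  tr (dpprod y v N * iprod y N * (Q - Qc N)) + tr (W * v k) *+ 4.
Proof.
move=> kN valt; rewrite (pw_form_sum yalt) dpprod_pconj //.
rewrite mulr_suml raddf_sum.
have term l : tr (uni v l * (\sum_(j < N) uni ham j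
      - \sum_(j < l.+1) uni ham j - \sum_(j < l) uni ham j)) =
    tr (uni v l * (Q - Qc N)) + tr (W * v k) *+ (if l == k then 4 else 0).
  rewrite !ham_prefix.
  have -> : (N < k)%N = false by lia.
  have -> : (N <= k.+1)%N = false by lia.
  (* [a] and [b] are the parts of the prefixes at [l.+1] and [l] that depend on [l]. *)
  have reduce a b : - Q - Qc N - (- Q + a) - (- Q + b) = Q - Qc N - (a + b).
    rewrite !opprD !opprK addrACA (addrC (- Q)) subrK.
    by rewrite addrCA -!addrA; congr (_ + _); rewrite addrCA.
  rewrite reduce mulrBr raddfB /=; congr (_ + _).
  have vl := valt l; have Qe := ham_even.
  have trQ : tr (uni v l * Qc l) = 0 by rewrite (tr_uni yalt) (uni_tr_even
    yalt vl Qe).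
  have trQS : tr (uni v l * Qc l.+1) = 0 by rewrite (tr_uniS yalt _ vl)
    (tr_odd_even vl).
  rewrite mulrDr raddfD /=.
  have [lk|[lk|[lk|[lk|lk]]]] : ((l.+1 < k) \/ (l.+1 = k) \/ (l = k) \/
      (l = k.+1) \/ (k.+1 < l))%N by lia.
  - have -> : (l < k)%N by lia.
    have -> : (l == k) = false by lia.
    by rewrite lk trQ trQS addr0 oppr0.
  - have -> : (l < k)%N by lia.
    have -> : (l.+1 < k)%N = false by lia.
    have -> : (l.+1 <= k.+1)%N by lia.
    have -> : (l == k) = false by lia.
    rewrite -lk mulrBr raddfB /= trQ trQS (tr_uniS yalt _ vl) mulrDr.
    have -> : v l * W = 0.
      by have := Wh; rewrite -lk; apply: homogM0 vl.
    by rewrite !addr0 raddf0 !oppr0 !addr0 oppr0.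
  - have -> : (l < k)%N = false by lia.
    have -> : (l.+1 < k)%N = false by lia.
    have -> : (l.+1 <= k.+1)%N by lia.
    have -> : (l <= k.+1)%N by lia.
    have -> : (l == k) by lia.
    rewrite -lk mulrBr raddfB /= trQ (tr_uni yalt) (uni_tr yalt vl); last first.
      by rewrite lk; apply: homogD.
    by rewrite sub0r -opprD opprK mulrDr raddfD /= trC lk !mulrS addr0 !addrA.
  - have -> : (l < k)%N = false by lia.
    have -> : (l <= k.+1)%N by lia.
    have -> : (l.+1 < k)%N = false by lia.
    have -> : (l.+1 <= k.+1)%N = false by lia.
    have -> : (l == k) = false by lia.
    (* In this form the prefix is a conjugate by the product of the letters before l = k + 1, as
       [tr_uni] requires. *)
    have -> : Qc k - Zm = - Qc l - Zp.
      by rewrite lk -[Zp](subrK Zm) Zp_Zm opprD opprK addrA (addrC (- _)) addrK.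
    rewrite mulrN raddfN /= trQS mulrBr mulrN raddfB raddfN /= trQ.
    rewrite -lk (tr_uni yalt) mulrBr mulr1 mulrBl mulrDr mulrDr.
    have -> : v l * W = 0.
      by move: vl; rewrite lk /= negbK => vl; apply: homogM0 vl Wh.
    have -> : v l * y l * W = 0 by rewrite -mulrA (W_y _).2 ?mulr0 // lk.
    by rewrite !addr0 subrr !raddf0 !(oppr0, addr0).
  - have -> : (l < k)%N = false by lia.
    have -> : (l <= k.+1)%N = false by lia.
    have -> : (l.+1 < k)%N = false by lia.
    have -> : (l.+1 <= k.+1)%N = false by lia.
    have -> : (l == k) = false by lia.
    by rewrite !mulrN !raddfN /= trQ trQS !(oppr0, addr0).
rewrite (eq_bigr (fun l : 'I_N => tr (uni v l * (Q - Qc N))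
   + tr (W * v k) *+ (if l == k :> nat then 4 else 0))); last by move=> l _.
rewrite big_split /=; congr (_ + _).
have kN' : (k < N)%N by lia.
rewrite (bigD1 (Ordinal kN')) //= eqxx big1 ?addr0 // => l neq.
by rewrite ifN // -[k]/(val (Ordinal kN')).
Qed.

End Hamiltonian.
End ProductForm.

(** * From two continuant corners to one block diagonal product *)

Section Corners.
Variables (S : pzRingType) (K : zmodType) (tr : {additive S -> K}).
Hypothesis trC : forall x y, tr (x * y) = tr (y * x).
Variable e : bool -> S.
Hypothesis eP : complementary_idempotents e.
Implicit Types (y u v : nat -> S) (l N : nat).

Definition jet_letters y u v l : 'M[S]_3 := jet (y l) (u l) (v l) 0.

Lemma jet_letters_alternating y u v :
  alternating e y -> alternating e u -> alternating e v ->
  alternating (jet_idem e) (jet_letters y u v).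
Proof. by move=> yh uh vh l; apply: jet_homog => //; apply: homog0. Qed.

Lemma even_sandwich b x : even_elt e x -> e b * x * e b = e b * x.
Proof. by move=> xe; rewrite -mulrA -xe mulrA eP.1. Qed.

Lemma jet_iprod y u v N : alternating e y -> alternating e u ->
  alternating e v ->
  let f := iprod y N in
  jet_top (iprod (jet_letters y u v) N) =
  f * dpprod y u N * f * dpprod y v N * f - f * d2pprod y u v N * f.
Proof.
move=> yh uh vh f; have Yh := jet_letters_alternating yh uh vh.
have Ysq0 := alternating_sq0 (jet_idemP eP) Yh.
have := pprodVl Ysq0 N; rewrite jet_pprod.
move=> /(jet_inverse (pprodV (alternating_sq0 eP yh) N)) ->.
by rewrite jet_topE.
Qed.

(** The second variation of the inverse is f a f b f - f D f. After multiplication by F, the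
    antisymmetrised terms in a and b cancel by cyclicity, as all factors commute with the
    idempotents; what remains on the [false] block completes the [true] block to a full trace. *)
Lemma corner_trace F f a b D D' :
  F * f = 1 -> even_elt e F -> even_elt e f -> even_elt e a -> even_elt e b ->
  tr (F * (e false * (f * a * f * b * f - f * D * f
                      - (f * b * f * a * f - f * D' * f)) * e false))
  - tr (f * (e true * (D - D') * e true)) = - tr (f * (D - D')).
Proof.
move=> Ff Fe fe ae be.
have trf c x : tr (f * (e c * x * e c)) = tr (f * x * e c).
  by rewrite !mulrA -fe trC !mulrA eP.1 [RHS]trC mulrA.
have trFe x : tr (F * (e false * (f * x * f) * e false)) = tr (f * x * e false).
  rewrite mulrA trC !mulrA even_sandwich // -!mulrA (mulrA F) Ff mul1r.
  by rewrite mulrA trC mulrA -fe -mulrA trC mulrA.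
have -> : f * a * f * b * f - f * D * f - (f * b * f * a * f - f * D' * f) =
    f * (a * f * b - b * f * a) * f - f * (D - D') * f.
  by rewrite !mulrBr !mulrBl !mulrA !opprD !opprK addrACA.
rewrite trf mulrBr mulrBl mulrBr raddfB /= !trFe.
have -> : tr (f * (a * f * b - b * f * a) * e false) = 0.
  rewrite mulrBr mulrBl raddfB /=; apply/eqP; rewrite subr_eq0; apply/eqP.
  rewrite !mulrA -(mulrA (f * a)) -mulrA trC -mulrA (even_eltM fe ae).
  by rewrite !mulrA.
by rewrite sub0r -opprD -raddfD -mulrDr (addrC (e false)) eP.2 mulr1.
Qed.

(** The forward continuant is a corner of F and the reversed one is the other corner of its inverse,
    also for jets. One term of the 2-form thus involves D^2 F and the other D^2 of F^-1, and
    [corner_trace] merges them. *)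
Lemma pw_form_corner y u v N : ~~ odd N ->
  alternating e y -> alternating e u -> alternating e v ->
  let F := pprod y N.+2 in
  let J u' v' j := jet_letters y u' v' j.+1 in
  even_elt e F -> even_elt e (dpprod y u N.+2) ->
  even_elt e (dpprod y v N.+2) ->
  tr (F * (e false * (jet_top (rprod (J u v) N) - jet_top (rprod (J v u) N))
           * e false))
  - tr (iprod y N.+2 *
        (e true * (jet_top (pprod (J u v) N) - jet_top (pprod (J v u) N))
           * e true))
  = - pw_form tr y N.+2 u v.
Proof.
move=> No yh uh vh F J Fe ue ve.
have ysq0 := alternating_sq0 eP yh.
set f := iprod y N.+2; have fe : even_elt e f.
  by apply: even_eltV Fe; [apply: pprodV | apply: pprodVl].
have pE u' v' : alternating e u' -> alternating e v' ->
    e true * jet_top (pprod (J u' v') N) * e true =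
    e true * d2pprod y u' v' N.+2 * e true.
  move=> uh' vh'; have Yh := jet_letters_alternating yh uh' vh'.
  rewrite -!jet_top_idem -(corner_pprod (jet_idemP eP) Yh No).
  by rewrite jet_pprod jet_top_idem jet_topE.
have rE u' v' : alternating e u' -> alternating e v' ->
    e false * jet_top (rprod (J u' v') N) * e false =
    e false * (f * dpprod y u' N.+2 * f * dpprod y v' N.+2 * f
       - f * d2pprod y u' v' N.+2 * f) * e false.
  move=> uh' vh'; have Yh := jet_letters_alternating yh uh' vh'.
  have Yh' : alternating (fun b => jet_idem e (~~ b)) (J u' v').
    by move=> l; apply: Yh l.+1.
  have eP' : complementary_idempotents (fun b => jet_idem e (~~ b)).
    have [ee e1] := jet_idemP eP; split=> [b|]; first exact: ee.
    by rewrite /= addrC.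
  rewrite -!jet_top_idem -(corner_iprod_rprod eP' Yh' true).
  by rewrite -(corner_iprod (jet_idemP eP) Yh No) jet_top_idem jet_iprod.
have tE : e true * (jet_top (pprod (J u v) N) - jet_top (pprod (J v u) N))
    * e true = e true * (d2pprod y u v N.+2 - d2pprod y v u N.+2) * e true.
  by rewrite !mulrBr !mulrBl !pE.
rewrite tE mulrBr mulrBl !rE // -mulrBl -mulrBr.
by apply: corner_trace => //; apply: pprodV.
Qed.

End Corners.

(** * Triangular factorisation by two additional letters *)

Section Extension.
Variable S : pzRingType.
Variable e : bool -> S.
Hypothesis eP : complementary_idempotents e.
Implicit Types (y u v : nat -> S).

Definition extend (N : nat) (x z : S) y (l : nat) : S :=
  if l == 0 then x else if l == N.+1 then z else y l.

Lemma extend_inner N x z y j : (j < N)%N -> extend N x z y j.+1 = y j.+1.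
Proof. by move=> jN; rewrite /extend eqSS (ltn_eqF jN). Qed.

Lemma extend_last N x z y : extend N x z y N.+1 = z.
Proof. by rewrite /extend eqxx. Qed.

Lemma extend_alternating N x z y : ~~ odd N ->
  homog e false true x -> homog e true false z -> alternating e y ->
  alternating e (extend N x z y).
Proof.
move=> No xh zh yh l; rewrite /extend; case: eqP => [->|_] //.
by case: eqP => [->|_] //=; rewrite (negbTE No).
Qed.

Lemma pprod_extend N x z y :
  pprod (extend N x z y) N.+2 =
  (1 + x) * pprod (fun j => y j.+1) N * (1 + z).
Proof.
rewrite pprodSl /= extend_last mulrA; congr (_ * _ * _).
by apply: eq_pprod => j; apply: extend_inner.
Qed.

Lemma dpprod_extend N x z y x' z' u :
  let g := pprod (fun j => y j.+1) N in
  let dg := dpprod (fun j => y j.+1) (fun j => u j.+1) N in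
  dpprod (extend N x z y) (extend N x' z' u) N.+2 =
  x' * g * (1 + z) + (1 + x) * dg * (1 + z) + (1 + x) * g * z'.
Proof.
move=> g dg; rewrite dpprodSl /= !extend_last.
have -> : pprod (fun j => extend N x z y j.+1) N = g.
  by apply: eq_pprod => j; apply: extend_inner.
have -> : dpprod (fun j => extend N x z y j.+1)
                 (fun j => extend N x' z' u j.+1) N = dg.
  by apply: eq_dpprod => j; apply: extend_inner.
by rewrite (mulrDr _ (dg * _)) !mulrA addrA.
Qed.

Section Triangular.
Variables (g dg Phi' : S).
Hypothesis Phi'h : homog e true true Phi'.
Hypothesis Phi'V : Phi' * (e true * g * e true) = e true.
Hypothesis PhiV' : e true * g * e true * Phi' = e true.

Let x := - (e false * g * Phi').
Let z := - (Phi' * g * e false).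

Lemma tri_x_homog : homog e false true x.
Proof.
apply: homogN; apply: homogP; first by rewrite !mulrA eP.1.
by rewrite -mulrA (homog_r eP Phi'h).
Qed.

Lemma tri_z_homog : homog e true false z.
Proof.
apply: homogN; apply: homogP; last by rewrite -mulrA eP.1.
by rewrite !mulrA (homog_l eP Phi'h).
Qed.

Lemma Phi'_g : Phi' * g * e true = e true.
Proof. by rewrite -(homog_r eP Phi'h) -[RHS]Phi'V !mulrA. Qed.

Lemma g_Phi' : e true * g * Phi' = e true.
Proof. by rewrite -(homog_l eP Phi'h) -[RHS]PhiV' !mulrA. Qed.

(** Block elimination with the invertible [true] corner of g as pivot: x clears one off-diagonal
    corner and z the other. *)
Lemma tri_even : even_elt e ((1 + x) * g * (1 + z)).
Proof.
apply: (even_corners eP) => -[] /=.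
  rewrite !mulrA (mulrDr (e true)) mulr1.
  rewrite (homog_l0 eP tri_x_homog : e true * x = 0) addr0.
  rewrite -!mulrA [(1 + z) * _]mulrDl mul1r (homog_r eP tri_z_homog).
  by rewrite mulrA (mulrDr (e true * g)) mulrN !mulrA g_Phi' subrr.
rewrite !mulrA (mulrDr (e false)) mulr1 (homog_l eP tri_x_homog).
rewrite -!mulrA [(1 + z) * _]mulrDl mul1r (homog_r0 eP tri_z_homog : z * e
  true = 0) addr0.
by rewrite /x mulrDl mulNr -!mulrA [Phi' * _]mulrA Phi'_g subrr.
Qed.

(** [x'] and [z'] are the variations of [x] and [z] when g varies by dg, since Phi' then varies by -
    Phi' dg Phi'. *)
Let x' := - ((e false + x) * dg * Phi').
Let z' := - (Phi' * dg * (e false + z)).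

Lemma tri_x'_homog : homog e false true x'.
Proof.
apply: homogN; apply: homogP; last by rewrite -mulrA (homog_r eP Phi'h).
by rewrite !mulrA mulrDr eP.1 (homog_l eP tri_x_homog).
Qed.

Lemma tri_z'_homog : homog e true false z'.
Proof.
apply: homogN; apply: homogP; first by rewrite !mulrA (homog_l eP Phi'h).
by rewrite -mulrA mulrDl eP.1 (homog_r eP tri_z_homog).
Qed.

Lemma dtri_even :
  even_elt e (x' * g * (1 + z) + (1 + x) * dg * (1 + z) + (1 + x) * g * z').
Proof.
apply: (even_corners eP) => -[] /=; rewrite 2!mulrDr 2!mulrDl !mulrA.
  rewrite (homog_l0 eP tri_x'_homog : e true * x' = 0) !mul0r add0r.
  rewrite (mulrDr (e true)) mulr1 (homog_l0 eP tri_x_homog : e true * x = 0)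
    addr0.
  rewrite -!mulrA (homog_r eP tri_z'_homog).
  rewrite [(1 + z) * _]mulrDl mul1r (homog_r eP tri_z_homog).
  by rewrite /z' !mulrN !mulrA g_Phi' subrr.
rewrite -!mulrA (homog_r0 eP tri_z'_homog : z' * e true = 0) !mulr0 addr0.
rewrite [(1 + z) * _]mulrDl mul1r (homog_r0 eP tri_z_homog : z * e true = 0)
  addr0.
rewrite !mulrA (homog_l eP tri_x'_homog) mulrDr mulr1 (homog_l eP tri_x_homog).
by rewrite /x' !mulNr -!mulrA [Phi' * _]mulrA Phi'_g addNr.
Qed.

End Triangular.
End Extension.

(** * The two-continuant form and its contraction with Hamiltonian variations *)

Section CornerForm.
Variables (S : pzRingType) (K : zmodType) (tr : {additive S -> K}).
Hypothesis trC : forall x y, tr (x * y) = tr (y * x).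
Variable e : bool -> S.
Hypothesis eP : complementary_idempotents e.
Variables (N : nat) (Y : nat -> S).
Hypothesis No : ~~ odd N.
Hypothesis Yalt : alternating e Y.
Local Notation shift f := (fun j => f j.+1).
Local Notation g := (pprod (shift Y) N).
Local Notation r := (rprod (shift Y) N).
Variables Phi' Psi' : S.
Hypothesis Phi'h : homog e true true Phi'.
Hypothesis Phi'V : Phi' * (e true * g * e true) = e true.
Hypothesis PhiV' : e true * g * e true * Phi' = e true.
Hypothesis Psi'h : homog e false false Psi'.
Hypothesis PsiV' : e false * r * e false * Psi' = e false.

(** Twice the 2-form; [Phi'] and [Psi'] invert the forward and the reversed continuant within their
    corners. *)
Definition corner_form (u v : nat -> S) : K :=
  let J a b := shift (jet_letters Y a b) in
  tr (Psi' * (jet_top (rprod (J u v) N) - jet_top (rprod (J v u) N)))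
  - tr (Phi' * (jet_top (pprod (J u v) N) - jet_top (pprod (J v u) N))).

(* The letters -p and -q, where g = (1 + p) h (1 + q) is the triangular
   factorisation with h even. *)
Let x := - (e false * g * Phi').
Let z := - (Phi' * g * e false).
Let y := extend N x z Y.
Variables F iF : S.
Hypotheses (FE : F = pprod y N.+2) (iFE : iF = iprod y N.+2).

Lemma extended_alternating : alternating e y.
Proof.
by apply: extend_alternating => //; [apply: tri_x_homog | apply: tri_z_homog].
Qed.

Let ysq0 := alternating_sq0 eP extended_alternating.

Lemma extended_even : even_elt e F.
Proof. by rewrite FE pprod_extend; apply: tri_even. Qed.

Let FV : F * iF = 1. Proof. by rewrite FE iFE; apply: pprodV. Qed.
Let VF : iF * F = 1. Proof. by rewrite FE iFE; apply: pprodVl. Qed.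

Lemma extended_even_inv : even_elt e iF.
Proof. exact: even_eltV FV VF extended_even. Qed.

Lemma iprod_corner_false : e false * iF * e false = e false * r * e false.
Proof.
rewrite iFE (corner_iprod eP extended_alternating No).
have -> : iprod (shift y) N = iprod (shift Y) N.
  by apply: eq_rprod => j jN; rewrite /y extend_inner.
have Yh' : alternating (fun b => e (~~ b)) (shift Y) 
  by move=> l; rewrite /homog; exact: (Yalt l.+1).
have eP' : complementary_idempotents (fun b => e (~~ b)).
  by split=> [b|]; [exact: eP.1 | rewrite addrC eP.2].
exact: (corner_iprod_rprod eP' Yh' true).
Qed.

(** Together with [extended_corner_true] this identifies F with the moment map: the inverse of the
    reversed continuant on one block, the forward continuant on the other. *)
Lemma extended_corner_false : F * e false = Psi'.
Proof.
have h1 := iprod_corner_false.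
rewrite -PsiV' -h1 (even_sandwich eP _ extended_even_inv).
by rewrite extended_even_inv !mulrA FV mul1r (homog_l eP Psi'h).
Qed.

Lemma extended_corner_true : iF * e true = Phi'.
Proof.
have h1 : e true * F * e true = e true * g * e true.
  rewrite FE (corner_pprod eP extended_alternating No).
  congr (_ * _ * _); apply: eq_pprod => j jN; by rewrite /y extend_inner.
rewrite -PhiV' -h1 (even_sandwich eP _ extended_even).
by rewrite extended_even !mulrA VF mul1r (homog_l eP Phi'h).
Qed.

Lemma iprod_corners : iF = Phi' + e false * r * e false.
Proof.
rewrite -iprod_corner_false (even_sandwich eP _ extended_even_inv).
by rewrite -extended_corner_true extended_even_inv -mulrDr eP.2 mulr1.
Qed.

Section Tangent.
Variables (V v : nat -> S).
Hypothesis Valt : alternating e V.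
Hypothesis Vv : forall j, (j < N)%N -> V j.+1 = v j.+1.
Hypothesis Veven : even_elt e (dpprod y V N.+2).

Lemma dpprod_corner_true :
  e true * dpprod y V N.+2 = e true * dpprod (shift Y) (shift v) N * e true.
Proof.
have J1 (a w b : nat -> S) : jet_mid (pprod (jet_letters a w b) N.+2) = dpprod
  a w N.+2.
  by rewrite jet_pprod jet_midE.
have Yh := jet_letters_alternating extended_alternating Valt Valt.
rewrite -(even_sandwich eP _ Veven) -(J1 _ _ V) -!jet_mid_idem.
rewrite (corner_pprod (jet_idemP eP) Yh No) jet_mid_idem.
rewrite jet_pprod jet_midE; congr (_ * _ * _).
by apply: eq_dpprod => j jN; [rewrite /y extend_inner | rewrite Vv].
Qed.

(** On this block the inverse of F, rather than F itself, is polynomial in the inner letters; its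
    variation is read off from the jets and then inverted. *)
Lemma dpprod_corner_false :
  e false * dpprod y V N.+2 =
  - (Psi' * drprod (shift Y) (shift v) N * Psi').
Proof.
have Yh := jet_letters_alternating extended_alternating Valt Valt.
have Ysq0 := alternating_sq0 (jet_idemP eP) Yh.
have Yh' : alternating (fun b => jet_idem e (~~ b)) (shift (jet_letters y V V)).
  by move=> l; rewrite /homog; exact: (Yh l.+1).
have eP' : complementary_idempotents (fun b => jet_idem e (~~ b)).
  have [ee e1] := jet_idemP eP; split=> [b|]; first exact: ee.
  by rewrite /= addrC.
have : jet_mid (jet_idem e false * iprod (jet_letters y V V) N.+2
                * jet_idem e false) =
       e false * drprod (shift Y) (shift v) N * e false.
  rewrite (corner_iprod (jet_idemP eP) Yh No).
  rewrite (corner_iprod_rprod eP' Yh' true) jet_mid_idem.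
  have -> : rprod (shift (jet_letters y V V)) N =
            rprod (shift (jet_letters Y v v)) N.
    apply: eq_rprod => j jN; rewrite /jet_letters /y extend_inner // Vv //.
  by have [w ->] := jet_rprod (shift Y) (shift v) (shift v) N; rewrite jet_midE.
have := pprodVl Ysq0 N.+2; rewrite jet_pprod -FE => /(jet_inverse FV) ->.
rewrite jet_mid_idem jet_midE => mid.
have -> : Psi' * drprod (shift Y) (shift v) N * Psi' =
    Psi' * (e false * drprod (shift Y) (shift v) N * e false) * Psi'.
  by rewrite !mulrA (homog_r eP Psi'h) -!mulrA (homog_l eP Psi'h).
rewrite -mid mulrN !mulNr mulrN mulNr opprK.
have -> : Psi' * (e false * (iF * dpprod y V N.+2 * iF) * e false) * Psi' =
    (Psi' * iF) * dpprod y V N.+2 * (iF * Psi').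
  by rewrite !mulrA (homog_r eP Psi'h) -!mulrA (homog_l eP Psi'h).
have -> : iF * Psi' = e false by rewrite -extended_corner_false mulrA VF mul1r.
have -> : Psi' * iF = e false.
  by rewrite -extended_corner_false -extended_even -mulrA FV mulr1.
by rewrite (even_sandwich eP _ Veven).
Qed.

Lemma dpprod_corners :
  dpprod y V N.+2 = e true * dpprod (shift Y) (shift v) N * e true
                    - Psi' * drprod (shift Y) (shift v) N * Psi'.
Proof.
rewrite -dpprod_corner_true -dpprod_corner_false -mulrDl eP.2.
by rewrite mul1r.
Qed.

End Tangent.

(** Any extensions of u and v to the outer letters will do, provided that the product stays block
    diagonal to first order: the corners only see the inner letters. *)
Lemma corner_formE U V u v :
  alternating e U -> alternating e V ->
  (forall j, (j < N)%N -> U j.+1 = u j.+1) ->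
  (forall j, (j < N)%N -> V j.+1 = v j.+1) ->
  even_elt e (dpprod y U N.+2) -> even_elt e (dpprod y V N.+2) ->
  corner_form u v = - pw_form tr y N.+2 U V.
Proof.
move=> Ualt Valt Uu Vv Ue Ve.
rewrite -(pw_form_corner trC eP No extended_alternating) //; last first.
  by rewrite -FE; apply: extended_even.
have trb b c A X : c * e b = X -> homog e b b X ->
    tr (c * (e b * A * e b)) = tr (X * A).
  by move=> cX Xh; rewrite !mulrA cX trC !mulrA (homog_l eP Xh).
rewrite -?FE -?iFE (trb _ _ _ _ extended_corner_false Psi'h).
rewrite -?FE -?iFE (trb _ _ _ _ extended_corner_true Phi'h).
rewrite /corner_form; congr (tr (_ * (jet_top _ - jet_top _))
    - tr (_ * (jet_top _ - jet_top _)));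
  (try apply: eq_rprod => j jN); (try apply: eq_pprod => j jN);
  by rewrite /jet_letters /y extend_inner // Uu // Vv.
Qed.

Lemma corner_form_ham V v k W Q :
  alternating e V -> (forall j, (j < N)%N -> V j.+1 = v j.+1) ->
  even_elt e (dpprod y V N.+2) ->
  (0 < k <= N)%N -> homog e (~~ odd k) (odd k) W ->
  Q = W * Y k - Y k * W ->
  corner_form v (ham Y k W Q) =
  - (tr (Q * (dpprod y V N.+2 * iF - iF * dpprod y V N.+2))
     + tr (W * v k) *+ 4).
Proof.
move=> Valt Vv Ve /andP[k_gt0 kN] Wh QE.
have yk : y k = Y k by case: k k_gt0 kN {Wh QE} => // k _; apply: extend_inner.
have QE' : Q = W * y k - y k * W by rewrite yk.
have Qe := ham_even eP extended_alternating Wh QE'.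
have Xalt := ham_homog eP extended_alternating Wh QE'.
have kN2 : (k.+2 <= N.+2)%N by [].
have conj : pconj y N.+2 Q = F * Q * iF by rewrite /pconj -FE -iFE.
(* By [ham_prefix] at the end of the word, the product varies by - (Q + F Q F^-1) F, which is even.
   The formula for all N + 2 letters is thus an admissible extension of the variation of the inner
   ones. *)
have Xe : even_elt e (dpprod y (ham y k W Q) N.+2).
  have -> : dpprod y (ham y k W Q) N.+2 = (- Q + - (F * Q * iF)) * F.
    rewrite -[LHS]mulr1 -VF mulrA; congr (_ * _).
    rewrite [in LHS]iFE (dpprod_pconj ysq0) (ham_prefix eP
      extended_alternating k_gt0 Wh QE').
    by rewrite conj !ifN //; lia.
  apply: even_eltM extended_even; apply: even_eltD; apply: even_eltN => //.
  apply: even_eltM extended_even_inv; apply: even_eltM Qe; exact: extended_even.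
have XX j : (j < N)%N -> ham y k W Q j.+1 = ham Y k W Q j.+1.
  by move=> jN; rewrite /ham /y extend_inner.
rewrite (corner_formE Valt Xalt Vv XX Ve Xe).
rewrite (pw_form_ham trC eP extended_alternating k_gt0 Wh QE' kN2 Valt).
have -> : V k = v k by case: k k_gt0 kN {Wh QE yk QE' Qe Xalt kN2 Xe XX} => //
  k _; apply: Vv.
rewrite conj -iFE; congr (- (_ + _)).
set D := dpprod _ _ _; rewrite !mulrBr !raddfB /=; congr (_ - _).
  by rewrite trC.
by rewrite !mulrA -(mulrA D) VF mulr1 trC !mulrA trC !mulrA.
Qed.
(** The outer letters vary by the derivatives of the formulas that define them. *)
Lemma tangent_extension v : alternating e v -> exists V,
  [/\ alternating e V, forall j, (j < N)%N -> V j.+1 = v j.+1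
    & even_elt e (dpprod y V N.+2)].
Proof.
move=> valt; pose dg := dpprod (shift Y) (shift v) N.
exists (extend N (- ((e false + x) * dg * Phi'))
                 (- (Phi' * dg * (e false + z))) v); split.
- apply: extend_alternating => //; first exact: tri_x'_homog.
  exact: tri_z'_homog.
- by move=> j; apply: extend_inner.
- by rewrite dpprod_extend; apply: dtri_even.
Qed.

End CornerForm.

Section CornerFormHamiltonian.
Variables (S : pzRingType) (K : zmodType) (tr : {additive S -> K}).
Hypothesis trC : forall x y, tr (x * y) = tr (y * x).
Variable e : bool -> S.
Hypothesis eP : complementary_idempotents e.

Lemma corner_form_eqr N Y Phi' Psi' u v v' :
  (forall j, (j < N)%N -> v j.+1 = v' j.+1) ->
  corner_form tr N Y Phi' Psi' u v = corner_form tr N Y Phi' Psi' u v'.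
Proof.
move=> vv'; rewrite /corner_form; congr (tr (_ * (jet_top _ - jet_top _))
    - tr (_ * (jet_top _ - jet_top _)));
  (try apply: eq_rprod => j jN); (try apply: eq_pprod => j jN);
  by rewrite /jet_letters vv'.
Qed.

(* [D] and [h'] are the derivative of the moment map in the direction [v] and
   the inverse of the moment map, as block diagonal elements. *)
Lemma corner_form_hamiltonian N Y Phi' Psi' v k W Q :
  let Y1 j := Y j.+1 in
  let r := e false * rprod Y1 N * e false in
  let D := e true * dpprod Y1 (fun j => v j.+1) N * e true
           - Psi' * drprod Y1 (fun j => v j.+1) N * Psi' in
  let h' := Phi' + r in
  ~~ odd N -> alternating e Y -> homog e true true Phi' ->
  Phi' * (e true * pprod Y1 N * e true) = e true ->
  e true * pprod Y1 N * e true * Phi' = e true ->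
  homog e false false Psi' -> r * Psi' = e false ->
  alternating e v -> (0 < k <= N)%N -> homog e (~~ odd k) (odd k) W ->
  Q = W * Y k - Y k * W ->
  corner_form tr N Y Phi' Psi' v (ham Y k W Q) =
  - (tr (Q * (D * h' - h' * D)) + tr (W * v k) *+ 4).
Proof.
move=> Y1 r D h' No Yalt Phi'h Phi'V PhiV' Psi'h PsiV' valt kN Wh QE.
have [V [Valt Vv Ve]] := tangent_extension eP No Phi'h Phi'V PhiV' valt.
rewrite (corner_form_ham trC eP No Yalt Phi'h Phi'V PhiV' Psi'h PsiV' erefl
  erefl Valt Vv Ve kN Wh QE).
rewrite (dpprod_corners eP No Yalt Phi'h Phi'V PhiV' Psi'h PsiV' erefl
  erefl Valt Vv Ve).
by rewrite (iprod_corners eP No Yalt Phi'h Phi'V PhiV' erefl erefl).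
Qed.

End CornerFormHamiltonian.

(** * Euler continuants as corners of products *)

Section AlternatingContinuants.
Variable S : pzRingType.

Definition alternating_upto (e : bool -> S) (k : nat) (y : nat -> S) : Prop :=
  forall l, (l < k)%N -> homog e (odd l) (~~ odd l) (y l).

Lemma complementary_idempotentsN (e : bool -> S) :
  complementary_idempotents e -> complementary_idempotents (fun b => e (~~ b)).
Proof. by move=> eP; split=> [b|]; [exact: eP.1 | rewrite addrC eP.2]. Qed.

(** In the expanded product the idempotents keep the monomials whose letters alternate in parity
    with the right ends. They arise from the full word by deleting adjacent pairs, which is Euler's
    rule. The induction removes [y 0], the rightmost factor, and this exchanges the two
    idempotents. *)
Lemma continuant_rev_rprod e k y : complementary_idempotents e ->
  alternating_upto e k y ->
  e (~~ odd k) * continuant_rev 1 [seq y j | j <- iota 0 k] * e true =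
  e (~~ odd k) * rprod y k * e true.
Proof.
have shiftE (f : nat -> S) m n :
    [seq f j | j <- iota m.+1 n] = [seq f j.+1 | j <- iota m n].
  by rewrite -add1n iotaDl -map_comp.
have shift_alt e' n f : alternating_upto e' n.+1 f ->
    alternating_upto (fun b => e' (~~ b)) n (fun j => f j.+1).
  by move=> fh l ln; rewrite /homog; exact: (fh l.+1).
elim/ltn_ind: k => -[|[|k]] IHk in e y *; move=> eP yh.
- by [].
- rewrite /= mulr1 mulrDr mulr1 mulrDl.
  by rewrite (idem_orthN eP true) add0r.
have eP' := complementary_idempotentsN eP.
have yh' := shift_alt _ _ _ yh.
have IH1 := IHk k.+1 (ltnSn _) _ _ eP' yh'.
have IH2 := IHk k (leqnSn _) _ _ (complementary_idempotentsN eP')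
              (shift_alt _ _ _ yh').
have {1}-> : [seq y j | j <- iota 0 k.+2] =
    y 0 :: y 1 :: [seq y j.+2 | j <- iota 0 k] by rewrite /= !shiftE.
rewrite -[continuant_rev _ _]/(continuant_rev 1 (y 1 :: [seq y j.+2 | j <-
  iota 0 k]) * y 0
   + continuant_rev 1 [seq y j.+2 | j <- iota 0 k]).
have {1}-> : y 1 :: [seq y j.+2 | j <- iota 0 k] =
    [seq y j.+1 | j <- iota 0 k.+1] by rewrite /= shiftE.
have y0 := yh 0 isT; have y1 := yh 1 isT.
have y0l : e false * y 0 = y 0 := homog_l eP y0.
have y0r : y 0 * e true = y 0 := homog_r eP y0.
have y1r : y 1 * e true = 0 := homog_r0 eP y1.
rewrite negbK in IH1; rewrite !negbK in IH2.
have -> : odd k.+2 = odd k by rewrite /= negbK.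
rewrite [rprod y k.+2]rprodSr.
move: IH1 (rprodSr (fun j => y j.+1) k); set R1 := rprod _ k.+1.
move: R1 => R1 IH1 R1E; rewrite mulrDr mulrDl IH2 -{1}y0l.
rewrite -!mulrA y0r !mulrA (IH1 : e (~~ odd k) * _ * e false = _) R1E.
rewrite -[e (odd k.+1)]/(e (~~ odd k)).
rewrite -!mulrA y0l -mulrDr -mulrDr; congr (_ * (_ * _)).
rewrite [(1 + y 0) * _]mulrDl mul1r y0r mulrDr addrC; congr (_ + _).
by rewrite mulrDl mul1r y1r addr0.
Qed.

Lemma rprod_rev (y : nat -> S) k : rprod (fun j => y (k.-1 - j)%N) k = pprod y
  k.
Proof.
elim: k => // k IHk; rewrite rprodSr /= subn0 -IHk; congr (_ * _).
by apply: eq_rprod => j jk; congr y; lia.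
Qed.

Lemma continuant_pprod e k (y : nat -> S) : complementary_idempotents e -> ~~
  odd k ->
  alternating_upto e k y ->
  e false * continuant 1 [seq y j | j <- iota 0 k] * e false =
  e false * pprod y k * e false.
Proof.
move=> eP ko yh; have eP' := complementary_idempotentsN eP.
have := @continuant_rev_rprod _ k (fun j => y (k.-1 - j)%N) eP'.
rewrite rprod_rev /= negbK (negbTE ko) => <-; last first.
  move=> l lk; have := yh (k.-1 - l)%N; rewrite /homog.
  have -> : odd (k.-1 - l) = ~~ odd l by lia.
  by apply; lia.
congr (_ * _ * _); rewrite /continuant; congr continuant_rev.
rewrite -map_rev; apply: (@eq_from_nth _ 0).
  by rewrite !size_map size_rev.
move=> i; rewrite size_map size_rev size_iota => ik.
rewrite !(nth_map 0) ?size_rev ?size_iota // nth_rev ?size_iota // !nth_iota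
  //; try lia.
by congr y; lia.
Qed.

Lemma continuant_rev_pprod e k y : complementary_idempotents e -> ~~ odd k ->
  alternating_upto e k y ->
  e true * continuant 1 (rev [seq y j | j <- iota 0 k]) * e true =
  e true * rprod y k * e true.
Proof.
move=> eP ko yh; have := continuant_rev_rprod eP yh.
by rewrite (negbTE ko) /continuant revK.
Qed.

End AlternatingContinuants.

(** * Free algebras and the evaluation of D^2 by jets *)

Section LinearExtension.
Variables (C : fieldType) (I : choiceType).

Definition lext (V : lmodType C) (F : I -> V) (g : malg I C) : V :=
  \sum_(k <- msupp g) mcoeff k g *: F k.

Section Linear.
Variables (V : lmodType C) (F : I -> V).

Lemma lextEw (d : {fset I}) g : (msupp g `<=` d)%fset ->
  lext F g = \sum_(k <- d) mcoeff k g *: F k.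
Proof.
move=> le; rewrite [LHS](big_fset_incl _ le) => //= k kd /mcoeff_outdom ->.
by rewrite scale0r.
Qed.

Lemma lext_is_linear : linear (lext F).
Proof.
move=> c g1 g2.
pose d := (msupp (c *: g1 + g2) `|` (msupp g1 `|` msupp g2))%fset.
rewrite !(@lextEw d) ?/d ?fsubsetUl //.
- rewrite scaler_sumr -big_split; apply: eq_bigr => k _ /=.
  by rewrite mcoeffD mcoeffZ scalerDl scalerA.
- by apply/fsubsetP => k kg; rewrite !in_fsetU kg !orbT.
- by apply/fsubsetP => k kg; rewrite !in_fsetU kg !orbT.
Qed.

HB.instance Definition _ :=
  GRing.isLinear.Build C (malg I C) V _ (lext F) lext_is_linear.

Lemma lextD g g' : lext F (g + g') = lext F g + lext F g'.
Proof. exact: raddfD. Qed.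

Lemma lextZ c g : lext F (c *: g) = c *: lext F g.
Proof. exact: linearZ. Qed.

Lemma lextU k c : lext F (mkmalgU k c) = c *: F k.
Proof. by rewrite (lextEw msuppU_le) big_seq_fset1 mcoeffUU. Qed.

End Linear.
End LinearExtension.

Section FreeAlgebra.
Variables (C : fieldType) (L : choiceType) (V : lmodType C).
Implicit Types p : ncpoly C L.

Lemma ncpoly_ind (P : ncpoly C L -> Prop) :
  P 0 -> (forall p q, P p -> P q -> P (p + q)) ->
  (forall c w, P (mkmalgU w c)) -> forall p, P p.
Proof.
move=> P0 PD PU p; rewrite (monalgE p).
by elim/big_ind: _ => // k _; apply: PU.
Qed.

Lemma lext_mulX (F : fmonom L -> V) p c :
  lext F (p * ncvar C c) = lext (fun w : fmonom L => F (FMonom (rcons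
    (fmonom_val w) c))) p.
Proof.
elim/ncpoly_ind: p => [|p q IHp IHq|a w].
- by rewrite mul0r !raddf0.
- apply: etrans (congr1 (lext F) (mulrDl p q _)) _.
  apply: etrans (lextD _ _ _) _; apply: etrans _ (esym (lextD _ _ _)).
  exact: congr2 IHp IHq.
- have -> : mkmalgU w a * ncvar C c = mkmalgU (fmmul w (fmu c)) a.
    by rewrite malgM_def /ncvar fgmulUU mulr1.
  by rewrite !lextU fmmulE fmuE cats1.
Qed.

Lemma lext1 (F : fmonom L -> V) : lext F 1 = F (FMonom [::]).
Proof.
have -> : 1 = mkmalgU (fmone L) 1 :> ncpoly C L by [].
by rewrite lextU scale1r fmoneE.
Qed.

End FreeAlgebra.

Section D2Evaluation.
Variables (R : realType) (V : lmodType R[i]) (L : choiceType) (N : nat).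
Variable rho : L -> V -> 'M[R[i]]_N.
Variable m : V.
Local Notation C := R[i].
Local Notation ncmono := (fmonom L).

Definition letter_jet (u v : V) (c : L) : 'M['M[C]_N]_3 :=
  jet (rho c m) (mx_diff (rho c) m u) (mx_diff (rho c) m v) 0.

Definition word_jet (u v : V) (w : seq L) : 'M['M[C]_N]_3 :=
  \prod_(c <- w) letter_jet u v c.

(** The words of [D2_word] for an arbitrary set of marked positions, so that an induction on the
    word can shift the positions. *)
Definition mark (P : pred nat) (w : seq L) : seq (L + L) :=
  [seq if P p.1 then inr p.2 else inl p.2 | p <- zip (iota 0 (size w)) w].

Lemma mark_cons P c w :
  mark P (c :: w) =
  (if P 0%N then inr c else inl c) :: mark (fun i => P i.+1) w.
Proof.
rewrite /mark /=; congr (_ :: _).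
suff eqs s : [seq if P p.1 then inr p.2 else inl p.2
    | p <- zip (iota s.+1 (size w)) w] =
  [seq if P p.1.+1 then inr p.2 else inl p.2 | p <- zip (iota s (size w)) w].
  exact: eqs.
by elim: w s => //= d w IHw s; rewrite IHw.
Qed.

Local Notation ev P w vs := (word_eval rho (mark P w) m vs).

(** Leibniz rule: in the top entry, the first letter is either unmarked or carries the first mark,
    evaluated on u, and then the rest of the word carries one mark, evaluated on v. *)
Lemma word_jetE u v w :
  word_jet u v w =
  jet (ev pred0 w [::])
      (\sum_(k < size w) ev (pred1 (val k)) w [:: u])
      (\sum_(k < size w) ev (pred1 (val k)) w [:: v])
      (\sum_(k < size w) \sum_(k' < size w | (k < k')%N)
         ev (fun i => (i == val k) || (i == val k')) w [:: u; v]).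
Proof.
elim: w => [|c w IHw].
  by rewrite /word_jet big_nil !big_ord0 /mark /= jet1.
have ev0 (P : pred nat) vs : ~~ P 0%N ->
    ev P (c :: w) vs = rho c m * ev (fun i => P i.+1) w vs.
  by rewrite mark_cons => /negbTE ->.
have ev1 (P : pred nat) x vs : P 0%N ->
    ev P (c :: w) (x :: vs) =
    mx_diff (rho c) m x * ev (fun i => P i.+1) w vs.
  by rewrite mark_cons => ->.
have D1 x : \sum_(k < size (c :: w)) ev (pred1 (val k)) (c :: w) [:: x] =
    rho c m * (\sum_(k < size w) ev (pred1 (val k)) w [:: x])
    + mx_diff (rho c) m x * ev pred0 w [::].
  rewrite big_ord_recl ev1 // addrC; congr (_ + _).
    rewrite mulr_sumr; apply: eq_bigr => k _; rewrite ev0 //.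
rewrite /word_jet big_cons -/(word_jet u v w) IHw jetM mul0r addr0.
rewrite -!D1 ev0 //; congr (jet _ _ _ _).
have mkcond n (P : pred 'I_n) (F : 'I_n -> 'M[C]_N) :
    \sum_(i < n | P i) F i = \sum_(i < n) if P i then F i else 0.
  exact: big_mkcond.
rewrite big_ord_recl addrC; congr (_ + _).
  rewrite [RHS]mkcond big_ord_recl ltnn add0r mulr_sumr.
  by apply: eq_bigr => k _; rewrite ev1.
rewrite mulr_sumr; apply: eq_bigr => k _.
rewrite [RHS]mkcond big_ord_recl ltn0 add0r mulr_sumr mkcond.
apply: eq_bigr => k' _; rewrite [(lift _ _ < _)%N]ltnS.
by case: ifP => // _; rewrite ev0.
Qed.

Lemma form2_evalE u v eta :
  form2_eval rho eta m u v =
  lext (fun w : fmonom (L + L)%type =>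
    word_eval rho (fmonom_val w) m [:: u; v]
    - word_eval rho (fmonom_val w) m [:: v; u]) eta.
Proof. by []. Qed.

Lemma form2_eval_D2_word u v w :
  form2_eval rho (D2_word C w) m u v =
  jet_top (word_jet u v w) - jet_top (word_jet v u w).
Proof.
rewrite form2_evalE !word_jetE !jet_topE /D2_word raddf_sum -sumrB.
apply: eq_bigr => k _; rewrite raddf_sum -sumrB.
by apply: eq_bigr => k' _; apply: etrans (lextU _ _ _) _; rewrite scale1r.
Qed.

Lemma form2_eval_D2 u v p :
  form2_eval rho (D2 p) m u v =
  lext (fun w : ncmono => jet_top (word_jet u v (fmonom_val w))
                        - jet_top (word_jet v u (fmonom_val w))) p.
Proof.
rewrite form2_evalE /D2 raddf_sum; apply: eq_bigr => w _.
apply: etrans (lextZ _ _ _) _; congr (_ *: _).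
exact: form2_eval_D2_word.
Qed.

(** The linear extension of [word_jet], entry by entry. The recursion of continuants only multiplies
    by letters on the right, so [poly_jet_mulX] is the multiplicativity that it requires. *)
Definition poly_jet u v (p : ncpoly C L) : 'M['M[C]_N]_3 :=
  \matrix_(i, j) lext (fun w : ncmono => word_jet u v (fmonom_val w) i j) p.

Lemma poly_jet_top u v p : jet_top (poly_jet u v p) =
  lext (fun w : ncmono => jet_top (word_jet u v (fmonom_val w))) p.
Proof. by rewrite /jet_top mxE. Qed.

Lemma poly_jetD u v p q :
  poly_jet u v (p + q) = poly_jet u v p + poly_jet u v q.
Proof. by apply/matrixP => i j; rewrite !mxE raddfD. Qed.

Lemma poly_jet1 u v : poly_jet u v 1 = 1.
Proof.
by apply/matrixP => i j; rewrite !mxE lext1 /word_jet big_nil !mxE.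
Qed.

Lemma poly_jet_mulX u v p c :
  poly_jet u v (p * ncvar C c) = poly_jet u v p * letter_jet u v c.
Proof.
apply/matrixP => i j; rewrite !mxE lext_mulX /lext.
under [RHS]eq_bigr do rewrite mxE /lext mulr_suml.
rewrite exchange_big; apply: eq_bigr => w _.
rewrite /word_jet -cats1 big_cat big_seq1 mxE scaler_sumr.
by apply: eq_bigr => k _; apply: scalemxAl.
Qed.

Lemma poly_jet_X u v c : poly_jet u v (ncvar C c) = letter_jet u v c.
Proof. by rewrite -[ncvar C c]mul1r poly_jet_mulX poly_jet1 mul1r. Qed.

Lemma poly_jet_continuant_rev u v (s : seq L) :
  poly_jet u v (continuant_rev 1 [seq ncvar C c | c <- s]) =
  continuant_rev 1 [seq letter_jet u v c | c <- s].
Proof.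
suff [] : poly_jet u v (continuant_rev 1 [seq ncvar C c | c <- s]) =
    continuant_rev 1 [seq letter_jet u v c | c <- s] /\
  poly_jet u v (continuant_rev 1 [seq ncvar C c | c <- behead s]) =
    continuant_rev 1 [seq letter_jet u v c | c <- behead s] by [].
elim: s => [|c [|d s] [IH1 IH2]].
- by split; apply: poly_jet1.
- by split; [apply: poly_jet_X | apply: poly_jet1].
- split=> [|//]; rewrite [LHS]poly_jetD poly_jet_mulX.
  by rewrite [poly_jet u v _ in LHS]IH1 [X in _ + X = _]IH2.
Qed.

Lemma poly_jet_continuant u v (s : seq L) :
  poly_jet u v (continuant 1 [seq ncvar C c | c <- s]) =
  continuant 1 [seq letter_jet u v c | c <- s].
Proof. by rewrite /continuant -!map_rev poly_jet_continuant_rev. Qed.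

Lemma form2_eval_continuant u v (s : seq L) :
  form2_eval rho (D2 (continuant 1 [seq ncvar C c | c <- s])) m u v =
  jet_top (continuant 1 [seq letter_jet u v c | c <- s])
  - jet_top (continuant 1 [seq letter_jet v u c | c <- s]).
Proof.
apply: etrans (form2_eval_D2 _ _ _) _.
have topE a b := etrans (esym (poly_jet_top a b _))
  (congr1 (@jet_top _) (poly_jet_continuant a b s)).
apply: etrans _ (congr2 (fun x y => x - y) (topE u v) (topE v u)).
rewrite /lext -sumrB; apply: eq_bigr => w _; exact: scalerBr.
Qed.

Section Linearity.
Hypothesis mx_diff_linear : forall c, linear (mx_diff (rho c) m).

Lemma word_eval_linear (w : seq (L + L)) u :
  linear (fun v => word_eval rho w m [:: v]) /\
  linear (fun v => word_eval rho w m [:: u; v]) /\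
  linear (fun v => word_eval rho w m [:: v; u]).
Proof.
have scaleAl (a : C) (A B : 'M[C]_N) : a *: A * B = a *: (A * B).
  by apply: esym; apply: scalemxAl.
have scaleAr (a : C) (A B : 'M[C]_N) : A * (a *: B) = a *: (A * B).
  by apply: esym; apply: scalemxAr.
elim: w => [|[c|c] w [IH1 [IH2 IH3]]].
- by split; [|split]; move=> a x y /=; rewrite scaler0 addr0.
- split; [|split]; move=> a x y /=.
  + by rewrite IH1 mulrDr scaleAr.
  + by rewrite IH2 mulrDr scaleAr.
  + by rewrite IH3 mulrDr scaleAr.
- split; [|split]; move=> a x y /=.
  + by rewrite mx_diff_linear mulrDl scaleAl.
  + by rewrite IH1 mulrDr scaleAr.
  + by rewrite mx_diff_linear mulrDl scaleAl.
Qed.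

Lemma form2_eval_linear eta u : linear (form2_eval rho eta m u).
Proof.
move=> a x y; rewrite /form2_eval scaler_sumr -big_split /=.
apply: eq_bigr => w _; have [_ [l1 l2]] := word_eval_linear (fmonom_val w) u.
rewrite l1 l2 scalerA mulrC -scalerA -scalerDr; congr (_ *: _).
by rewrite scalerBr opprD addrACA.
Qed.

End Linearity.
End D2Evaluation.

(** * Derivatives of matrix functions *)

Section MatrixDerivatives.
Variable K : numFieldType.

Definition is_mx_derive (p q : nat) (F : K -> 'M[K]_(p, q)) (t : K)
    (D : 'M[K]_(p, q)) : Prop :=
  forall i j, is_derive t (1 : K) (fun s => F s i j : K^o) (D i j).

Section Rules.
Variables (p q r : nat) (t : K).

Lemma near_eq_is_mx_derive (F G : K -> 'M[K]_(p, q)) D :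
  (\near t, F t = G t) -> is_mx_derive F t D -> is_mx_derive G t D.
Proof.
move=> FG dF i j; apply: near_eq_is_derive (dF i j).
by apply: filterS FG => s ->.
Qed.

Lemma is_mx_derive_cst (A : 'M[K]_(p, q)) : is_mx_derive (fun=> A) t 0.
Proof. by move=> i j; rewrite mxE; apply: is_derive_cst. Qed.

Lemma is_mx_deriveD (F G : K -> 'M[K]_(p, q)) D E :
  is_mx_derive F t D -> is_mx_derive G t E ->
  is_mx_derive (fun s => F s + G s) t (D + E).
Proof.
move=> dF dG i j; rewrite mxE.
have -> : (fun s => (F s + G s) i j) =
    (fun s => F s i j : K^o) + (fun s => G s i j : K^o).
  by apply/funext => s; rewrite mxE.
exact: is_deriveD.
Qed.

Lemma is_mx_deriveM (F : K -> 'M[K]_(p, q)) (G : K -> 'M[K]_(q, r)) D E :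
  is_mx_derive F t D -> is_mx_derive G t E ->
  is_mx_derive (fun s => F s *m G s) t (D *m G t + F t *m E).
Proof.
move=> dF dG i j.
have -> : (fun s => (F s *m G s) i j : K^o) =
    \sum_(k < q) ((fun s => F s i k : K^o) * (fun s => G s k j : K^o)).
  by apply/funext => s; rewrite mxE fct_sumE.
have -> : (D *m G t + F t *m E) i j =
    \sum_(k < q) (F t i k *: E k j + G t k j *: D i k).
  rewrite !mxE -big_split /=; apply: eq_bigr => k _.
  by rewrite addrC [G t k j *: _]mulrC.
by apply: is_derive_sum => k; apply: is_deriveM.
Qed.

Lemma is_mx_derive_affine (A B : 'M[K]_(p, q)) :
  is_mx_derive (fun s => A + s *: B) t B.
Proof.
move=> i j.
have -> : (fun s => (A + s *: B) i j : K^o) =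
    cst (A i j) + ((fun s => s : K^o) * cst (B i j)).
  by apply/funext => s; rewrite !mxE.
have dB := is_deriveM (is_derive_id t (1 : K)) (is_derive_cst (B i j) t (1 :
  K)).
apply: is_derive_eq (is_deriveD (is_derive_cst (A i j) t (1 : K)) dB) _.
by rewrite add0r scaler0 add0r; apply: mulr1.
Qed.

Lemma is_mx_derive_unique (F : K -> 'M[K]_(p, q)) D E :
  is_mx_derive F t D -> is_mx_derive F t E -> D = E.
Proof.
move=> dF dG; apply/matrixP => i j.
by have [_ <-] := dF i j; have [_ <-] := dG i j.
Qed.

End Rules.

Lemma derivable_prod (I : Type) (s : seq I) (f : I -> K -> K^o) t :
  (forall i, derivable (f i) t 1) ->
  derivable (fun x => \prod_(i <- s) f i x : K^o) t 1.
Proof.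
move=> df; elim: s => [|i s IHs].
  under eq_fun do rewrite big_nil.
  exact: derivable_cst.
under eq_fun do rewrite big_cons.
exact: derivableM.
Qed.

Lemma derivable_det n (F : K -> 'M[K]_n) t :
  (forall i j, derivable (fun s => F s i j : K^o) t 1) ->
  derivable (fun s => \det (F s) : K^o) t 1.
Proof.
move=> dF.
have -> : (fun s => \det (F s) : K^o) = \sum_(w : {perm 'I_n})
    (cst ((-1) ^+ w : K^o) * (fun s => \prod_i F s i (w i) : K^o)).
  by apply/funext => s; rewrite fct_sumE.
elim: (index_enum _) => [|w l IHl].
  by rewrite big_nil; apply: derivable_cst.
rewrite big_cons; apply: derivableD => //; apply: derivableM.
  exact: derivable_cst.
by apply: derivable_prod => i; apply: dF.
Qed.

Lemma near_unitmx n (F : K -> 'M[K]_n) t D :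
  is_mx_derive F t D -> F t \in unitmx -> \forall s \near t, F s \in unitmx.
Proof.
move=> dF Fu.
have := derivable_det (fun i j => @ex_derive _ _ _ _ _ _ _ (dF i j)).
move=> /derivable1_diffP/differentiable_continuous cdet.
have det0 : \det (F t) != 0 by rewrite -unitfE -unitmxE.
have nz : \forall s \near t, \det (F s) != 0 by apply: cvgr_neq0 cdet det0.
apply: filterS nz => s sn0.
by rewrite unitmxE unitfE.
Qed.

(** Cramer's formula, valid near t, shows that the entries of the inverse are derivable; the value
    then follows by differentiating F F^-1 = 1. *)
Lemma is_mx_deriveV n (F : K -> 'M[K]_n) t D :
  is_mx_derive F t D -> F t \in unitmx ->
  is_mx_derive (fun s => invmx (F s)) t (- (invmx (F t) *m D *m invmx (F t))).
Proof.
move=> dF Fu; have Fnear := near_unitmx dF Fu.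
have dFij i j := @ex_derive _ _ _ _ _ _ _ (dF i j).
have det0 : \det (F t) != 0 by rewrite -unitfE -unitmxE.
have dV i j : derivable (fun s => invmx (F s) i j : K^o) t 1.
  have : derivable ((fun s => (\det (F s))^-1 : K^o) *
                    (fun s => cofactor (F s) j i : K^o)) t 1.
    apply: derivableM.
      by apply: derivableV => //; apply: derivable_det.
    rewrite /cofactor; apply: derivableM; first exact: derivable_cst.
    apply: derivable_det => k l; under eq_fun do rewrite !mxE.
    exact: dFij.
  apply: near_eq_derivable; near=> s.
  have su : F s \in unitmx by near: s.
  by rewrite /invmx su !mxE.
pose E := \matrix_(i, j) 'D_1 (fun s => invmx (F s) i j : K^o) t.
have dE : is_mx_derive (fun s => invmx (F s)) t E.
  by move=> i j; rewrite mxE; apply: derivableP.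
suff <- : E = - (invmx (F t) *m D *m invmx (F t)) by [].
have d1 : is_mx_derive (fun s => F s *m invmx (F s)) t 0.
  apply: near_eq_is_mx_derive (is_mx_derive_cst _ 1%:M).
  near=> s; rewrite mulmxV //; by near: s.
have := is_mx_derive_unique (is_mx_deriveM dF dE) d1.
move=> /(congr1 (mulmx (invmx (F t)))); rewrite mulmx0 mulmxDr !mulmxA.
by rewrite mulVmx // mul1mx => /eqP; rewrite addrC addr_eq0 => /eqP.
Unshelve. all: by end_near. Qed.

Lemma is_mx_derive_pprod n (y : nat -> K -> 'M[K]_n) (u : nat -> 'M[K]_n) t l :
  (forall j, is_mx_derive (y j) t (u j)) ->
  is_mx_derive (fun s => pprod (y^~ s) l) t (dpprod (y^~ t) u l).
Proof.
move=> dy; elim: l => [|l IHl] /=; first exact: is_mx_derive_cst.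
apply: (is_mx_deriveM IHl).
rewrite -[u l]add0r; apply: is_mx_deriveD => //; exact: is_mx_derive_cst.
Qed.

Lemma is_mx_derive_rprod n (y : nat -> K -> 'M[K]_n) (u : nat -> 'M[K]_n) t l :
  (forall j, is_mx_derive (y j) t (u j)) ->
  is_mx_derive (fun s => rprod (y^~ s) l) t (drprod (y^~ t) u l).
Proof.
move=> dy; elim: l => [|l IHl] /=; first exact: is_mx_derive_cst.
apply: is_mx_deriveM => //.
rewrite -[u l]add0r; apply: is_mx_deriveD => //; exact: is_mx_derive_cst.
Qed.

End MatrixDerivatives.

(** A quadratic remainder bound gives the derivative of the exponential at 0 without differentiating
    its series term by term. *)
Lemma is_derive_quadratic (K : numFieldType) (f : K -> K^o) (a b M r : K) :
  0 <= M -> 0 < r ->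
  (forall h, `|h| <= r -> `|f h - a - h * b| <= M * `|h| ^+ 2) ->
  is_derive (0 : K) 1 f b.
Proof.
move=> M0 r0 fle.
have f0 : f 0 = a.
  apply/eqP; rewrite -subr_eq0 -normr_le0; have := fle 0.
  by rewrite normr0 mul0r subr0 expr0n mulr0; apply; apply: ltW.
suff cvgf : ((fun h : K => h^-1 *: ((f \o shift 0) (h *: 1) - f 0))
    @ 0^' --> (b : K^o))%classic.
  by apply: DeriveDef; [apply/cvg_ex; exists b | apply: cvg_lim].
apply/cvgrPdist_lt => e e0; near=> h.
have h0 : h != 0 by near: h; exact: nbhs_dnbhs_neq.
have hr : `|h| <= r.
  near: h; exact: dnbhs0_le.
have he : `|h| < e / (M + 1).
  by near: h; apply: dnbhs0_lt; rewrite divr_gt0 // ltr_wpDl.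
rewrite /= addr0 f0 [h *: 1]mulr1.
have -> : b - h^-1 *: (f h - a) = - (h^-1 *: (f h - a - h * b)).
  have hb : h^-1 *: (h * b : K^o) = b by apply: mulKf.
  by rewrite -[in LHS]hb -scalerBr -scalerN [in RHS]opprB.
rewrite normrN normrZ normfV mulrC ltr_pdivrMr ?normr_gt0 //.
apply: le_lt_trans (fle _ hr) _.
rewrite expr2 mulrA ltr_pM2r ?normr_gt0 //.
apply: (@le_lt_trans _ _ (`|h| * (M + 1))).
  by rewrite mulrC ler_wpM2l // lerDl.
by rewrite -ltr_pdivlMr // ltr_wpDl.
Unshelve. all: by end_near. Qed.

(** * Complex series and the matrix exponential near zero *)

Section ComplexSeries.
Local Open Scope classical_set_scope.
Variable R : realType.
Local Notation C := R[i].
Local Notation Re := (@complex.Re R).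
Local Notation Im := (@complex.Im R).

Lemma normc_Re_le (z : C) : `|Re z|%:C <= `|z|.
Proof.
rewrite normc_def lecR -sqrtr_sqr; apply: ler_wsqrtr.
by rewrite lerDl sqr_ge0.
Qed.

Lemma normc_Im_le (z : C) : `|Im z|%:C <= `|z|.
Proof.
rewrite normc_def lecR -sqrtr_sqr; apply: ler_wsqrtr.
by rewrite lerDr sqr_ge0.
Qed.

Lemma normc_le_ReIm (z : C) : `|z| <= (`|Re z| + `|Im z|)%:C.
Proof.
rewrite normc_def lecR -[leRHS]ger0_norm ?addr_ge0 // -sqrtr_sqr.
apply: ler_wsqrtr; rewrite sqrrD !real_normK ?num_real //.
by rewrite -addrA lerD2l lerDr mulrn_wge0 // mulr_ge0.
Qed.

Lemma cvg_complex (u : nat -> C) (a b : R) :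
  (fun n => Re (u n)) @ \oo --> a -> (fun n => Im (u n)) @ \oo --> b ->
  (u : nat -> C^o) @ \oo --> (a +i* b : C^o).
Proof.
move=> ua ub; apply/cvgrPdist_lt => e; rewrite ltcE => /andP[/eqP/= e0 e_gt0].
(* A positive complex number is real. *)
have eE : e = (Re e)%:C by case: (e) e0 => x y /= ->.
have e2 : 0 < Re e / 2 by rewrite divr_gt0.
have /cvgrPdist_lt/(_ _ e2) ua' := ua; have /cvgrPdist_lt/(_ _ e2) ub' := ub.
near=> n; apply: le_lt_trans (normc_le_ReIm _) _; rewrite eE ltcR.
rewrite (splitr (Re e)); apply: ltrD.
  have : `|a - Re (u n)| < Re e / 2 by near: n; exact: ua'.
  by case: (u n).
have : `|b - Im (u n)| < Re e / 2 by near: n; exact: ub'.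
by case: (u n).
Unshelve. all: by end_near. Qed.

Lemma is_cvg_geometric_dominated (u : nat -> R) :
  (forall k, `|u k| <= (2^-1) ^+ k) -> cvgn (series u).
Proof.
move=> ule; apply: normed_cvg.
apply: (@series_le_cvg _ _ (fun k => (2^-1) ^+ k)) => //.
- by move=> k /=.
- rewrite exprn_geometric; apply: is_cvg_geometric_series.
  by rewrite ger0_norm ?invr_ge0 // invf_lt1 // ltr1n.
Qed.

Lemma is_cvg_complex_series (u : nat -> C) :
  (forall k, `|u k| <= ((2^-1) ^+ k)%:C) -> cvgn (series (u : nat -> C^o)).
Proof.
move=> ule.
have sR n : Re (series u n) = series (fun k => Re (u k)) n.
  by rewrite /series /= raddf_sum.
have sI n : Im (series u n) = series (fun k => Im (u k)) n.
  by rewrite /series /= raddf_sum.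
have /cvg_ex[a ua] : cvgn (series (fun k => Re (u k))).
  apply: is_cvg_geometric_dominated => k; rewrite -lecR.
  exact: le_trans (normc_Re_le _) (ule k).
have /cvg_ex[b ub] : cvgn (series (fun k => Im (u k))).
  apply: is_cvg_geometric_dominated => k; rewrite -lecR.
  exact: le_trans (normc_Im_le _) (ule k).
apply/cvg_ex; exists (a +i* b); apply: cvg_complex.
  by under eq_fun do rewrite sR.
by under eq_fun do rewrite sI.
Qed.

End ComplexSeries.

Section Exponential.
Local Open Scope classical_set_scope.
Variables (R : realType) (d : nat).
Local Notation C := R[i].
Implicit Types X : 'M[C]_d.

Definition entry_sum X : C := \sum_i \sum_j `|X i j|.

Lemma entry_sum_ge0 X : 0 <= entry_sum X.
Proof. by apply: sumr_ge0 => i _; apply: sumr_ge0. Qed.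

Lemma row_le_entry_sum X i : \sum_j `|X i j| <= entry_sum X.
Proof.
rewrite /entry_sum [leRHS](bigD1 i) //= lerDl.
by apply: sumr_ge0 => k _; apply: sumr_ge0.
Qed.

Lemma entry_sumZ t X : entry_sum (t *: X) = `|t| * entry_sum X.
Proof.
rewrite mulr_sumr; apply: eq_bigr => i _; rewrite mulr_sumr.
by apply: eq_bigr => j _; rewrite mxE normrM.
Qed.

Lemma expr_entry_le X k i j : `|(X ^+ k) i j| <= (entry_sum X) ^+ k.
Proof.
elim: k i j => [|k IHk] i j.
  by rewrite expr0 mxE; case: (_ == _); rewrite ?normr1 ?normr0.
rewrite exprS mxE; apply: le_trans (ler_norm_sum _ _ _) _.
apply: (@le_trans _ _ (\sum_l `|X i l| * entry_sum X ^+ k)).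
  by apply: ler_sum => l _; rewrite normrM ler_wpM2l.
rewrite -mulr_suml exprS ler_wpM2r ?exprn_ge0 ?entry_sum_ge0 //.
exact: row_le_entry_sum.
Qed.

Definition exp_term X i j k : C := (k`!%:R)^-1 * (X ^+ k) i j.

(** The factorials are discarded: only matrices with [entry_sum X] at most 1/2 occur, and for them a
    geometric series is a sufficient bound. *)
Lemma exp_term_le X i j k : `|exp_term X i j k| <= (entry_sum X) ^+ k.
Proof.
rewrite /exp_term normrM; apply: le_trans (expr_entry_le X k i j).
rewrite -[leRHS]mul1r ler_wpM2r // ger0_norm ?invr_ge0 //.
by rewrite invf_le1 ?ler1n ?ltr0n ?fact_gt0.
Qed.

(** Past the linear term the sum is dominated by the square of [entry_sum X] times a geometric sum
    of ratio 1/2, which is at most 2. *)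
Lemma exp_partial_sum X i j n : entry_sum X <= 2^-1 -> (2 <= n)%N ->
  `|series (exp_term X i j) n - (1%:M + X) i j| <= 2 * entry_sum X ^+ 2.
Proof.
move=> Xle; case: n => [|[|n]] // _.
have -> : (1%:M + X) i j = exp_term X i j 0 + exp_term X i j 1.
  by rewrite /exp_term !invr1 !mul1r expr0 expr1 !mxE.
rewrite /series /= big_nat_recl // big_nat_recl //.
rewrite addrA [X in X - _]addrC addrK.
apply: le_trans (ler_norm_sum _ _ _) _.
apply: (@le_trans _ _ (\sum_(0 <= k < n) entry_sum X ^+ 2 * (2^-1) ^+ k)).
  apply: ler_sum => k _; apply: le_trans (exp_term_le _ _ _ _) _.
  rewrite -addn2 addnC exprD ler_wpM2l ?exprn_ge0 ?entry_sum_ge0 //.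
  by apply: lerXn2r; rewrite ?nnegrE ?entry_sum_ge0 ?invr_ge0.
rewrite -mulr_sumr mulrC; apply: ler_wpM2r.
  by rewrite exprn_ge0 ?entry_sum_ge0.
have -> : \sum_(0 <= k < n) (2^-1 : C) ^+ k = 2 - 2 * 2^-1 ^+ n.
  elim: n => [|n IHn]; first by rewrite big_nil expr0 mulr1 subrr.
  rewrite big_nat_recr //= IHn exprS; by field.
by rewrite lerBlDr lerDl mulr_ge0 // exprn_ge0 // invr_ge0.
Qed.

Lemma exp_series_cvg X i j : entry_sum X <= 2^-1 ->
  cvgn (series (exp_term X i j : nat -> C^o)).
Proof.
move=> Xle; apply: is_cvg_complex_series => k.
apply: le_trans (exp_term_le _ _ _ _) _.
rewrite rmorphXn /= fmorphV rmorph_nat.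
by apply: lerXn2r; rewrite ?nnegrE ?entry_sum_ge0 ?invr_ge0.
Qed.

(** The slack e absorbs the distance from the limit to a partial sum. *)
Lemma expmx_approx X i j (e : C) : entry_sum X <= 2^-1 -> 0 < e ->
  `|expmx X i j - (1%:M + X) i j| <= e + 2 * entry_sum X ^+ 2.
Proof.
move=> Xle e0; have cX := @exp_series_cvg X i j Xle.
rewrite [expmx X i j]mxE; set l := limn _.
have /cvgrPdist_lt/(_ _ e0) near_l : series (exp_term X i j : nat -> C^o) @
  \oo --> l.
  exact: cX.
near \oo => n.
rewrite -(subrK (series (exp_term X i j) n) l) -addrA.
apply: le_trans (ler_normD _ _) _; apply: lerD.
  by apply: ltW; near: n; exact: near_l.
apply: exp_partial_sum => //; near: n; exact: nbhs_infty_ge.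
Unshelve. all: by end_near. Qed.

Lemma expmx0 : expmx 0 = 1%:M :> 'M[C]_d.
Proof.
have s0 : entry_sum 0 = 0 by apply: big1 => i _; apply: big1 => j _; rewrite
  mxE normr0.
apply/matrixP => i j; apply/eqP; rewrite -subr_eq0 -normr_le0.
apply/ler_addgt0Pl => e e0; rewrite addr0.
have := @expmx_approx 0 i j e; rewrite s0 expr0n mulr0 !addr0.
by apply; rewrite ?invr_ge0.
Qed.

Lemma is_mx_derive_expmx X : is_mx_derive (fun t => expmx (t *: X)) 0 X.
Proof.
move=> i j; pose s := entry_sum X; have s0 : 0 <= s := entry_sum_ge0 X.
(* The radius keeps |h| s below 1/2. The constant comes from [expmx_approx] with e = |h|^2, which is
   positive only for h nonzero; hence the separate case h = 0. *)
apply: (@is_derive_quadratic _ _ (expmx 0 i j) _ (1 + 2 * s ^+ 2)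
  ((2 * (1 + s))^-1)).
- by rewrite addr_ge0 // mulr_ge0 // exprn_ge0.
- by rewrite invr_gt0 mulr_gt0 // ltr_wpDr.
move=> h hle; have [->|h0] := eqVneq h 0.
  by rewrite scale0r mul0r subr0 subrr normr0 expr0n mulr0.
have hs : entry_sum (h *: X) <= 2^-1.
  rewrite entry_sumZ -/s.
  apply: le_trans (ler_wpM2r s0 hle) _.
  rewrite invfM -mulrA ger_pMr ?invr_gt0 //.
  by rewrite mulrC ler_pdivrMr ?mul1r ?lerDr // ltr_wpDr.
have := @expmx_approx (h *: X) i j (`|h| ^+ 2) hs.
rewrite exprn_gt0 ?normr_gt0 // => /(_ isT).
rewrite entry_sumZ exprMn -/s.
have -> : `|h| ^+ 2 + 2 * (`|h| ^+ 2 * s ^+ 2) = (1 + 2 * s ^+ 2) * `|h| ^+ 2.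
  by ring.
by rewrite expmx0 !mxE opprD addrA.
Qed.

End Exponential.

(** * The letters of a representation and their continuants *)

Section Letters.
Variables (R : realType) (n d1 d2 : nat).
Local Notation C := R[i].
Local Notation V := (rep_space R n d1 d2).
Local Notation E := 'M[C]_(d1 + d2).
Implicit Types (m u v : V) (c : 'I_n + 'I_n).

Definition vertex_idem (b : bool) : E :=
  if b then block_mx 0 0 0 1%:M else block_mx 1%:M 0 0 0.

Lemma vertex_idemP : complementary_idempotents vertex_idem.
Proof.
split=> [[]|]; rewrite /vertex_idem.
- by rewrite [LHS]mulmx_block !mulmx0 !mul0mx mulmx1 !addr0 add0r.
- by rewrite [LHS]mulmx_block !mulmx0 !mul0mx mulmx1 !addr0.
- by rewrite add_block_mx !addr0 add0r -scalar_mx_block.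
Qed.

Lemma corner_true (M : E) : vertex_idem true * M * vertex_idem true =
  block_mx 0 0 0 (drsubmx M).
Proof.
rewrite -[M in LHS]submxK /vertex_idem.
rewrite [X in X * _]mulmx_block [LHS]mulmx_block.
by rewrite !mulmx0 !mul0mx !mulmx1 !mul1mx !addr0 !add0r.
Qed.

Lemma corner_false (M : E) : vertex_idem false * M * vertex_idem false =
  block_mx (ulsubmx M) 0 0 0.
Proof.
rewrite -[M in LHS]submxK /vertex_idem.
rewrite [X in X * _]mulmx_block [LHS]mulmx_block.
by rewrite !mulmx0 !mul0mx !mulmx1 !mul1mx !addr0.
Qed.

Definition arrow_nat (k : nat) : option ('I_n + 'I_n) :=
  omap (fun i => if odd k then inr i else inl i) (insub k./2).

Lemma arrow_nat_double (i : 'I_n) : arrow_nat i.*2 = Some (inl i).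
Proof. by rewrite /arrow_nat odd_double doubleK valK. Qed.

Lemma arrow_nat_doubleS (i : 'I_n) : arrow_nat i.*2.+1 = Some (inr i).
Proof. by rewrite /arrow_nat /= odd_double /= uphalf_double valK. Qed.

Lemma map_arrows (T : Type) (x0 : T) (F : 'I_n + 'I_n -> T) :
  [seq F c | c <- interleave inl inr] =
  [seq oapp F x0 (arrow_nat k) | k <- iota 0 n.*2].
Proof.
pose G k := oapp F x0 (arrow_nat k).
have iotaG p q : flatten [seq [:: G k.*2; G k.*2.+1] | k <- iota p q] =
    [seq G k | k <- iota p.*2 q.*2].
  by elim: q p => //= q IHq p; rewrite IHq.
rewrite -/(G) -[0%N in RHS]double0 -iotaG -val_enum_ord -map_comp.
rewrite /interleave map_flatten -map_comp; congr flatten.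
apply: eq_map => i /=; rewrite /G.
by rewrite arrow_nat_double arrow_nat_doubleS.
Qed.

(* The l-th letter of the word A_1 B_1 ... A_n B_n for [1 <= l <= 2n], and 0
   otherwise. *)
Definition letter m (l : nat) : E :=
  if l is k.+1 then oapp (fun c => arrow_mx c m) 0 (arrow_nat k) else 0.

Definition arrow_pos c : nat :=
  match c with inl i => i.*2.+1 | inr i => i.*2.+2 end.

Lemma letter_pos m c : letter m (arrow_pos c) = arrow_mx c m.
Proof.
by case: c => i; rewrite /= ?arrow_nat_double ?arrow_nat_doubleS.
Qed.

Lemma arrow_pos_bound c : (0 < arrow_pos c <= n.*2)%N.
Proof. by case: c => i /=; have := ltn_ord i; lia. Qed.

Lemma homog_block_dl (A : 'M[C]_(d2, d1)) :
  homog vertex_idem true false (block_mx 0 0 A 0).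
Proof.
rewrite /homog /vertex_idem [X in X * _]mulmx_block [LHS]mulmx_block.
by rewrite !mulmx0 !mul0mx !mulmx1 !mul1mx !addr0 !add0r.
Qed.

Lemma homog_block_ur (B : 'M[C]_(d1, d2)) :
  homog vertex_idem false true (block_mx 0 B 0 0).
Proof.
rewrite /homog /vertex_idem [X in X * _]mulmx_block [LHS]mulmx_block.
by rewrite !mulmx0 !mul0mx !mulmx1 !mul1mx !addr0 !add0r.
Qed.

Lemma letter_alternating m : alternating vertex_idem (letter m).
Proof.
case=> [|k]; first exact: homog0.
rewrite /= /arrow_nat; case: insub => [i|] /=; last exact: homog0.
by case: (odd k); [apply: homog_block_ur | apply: homog_block_dl].
Qed.

Lemma arrow_mx_linear c : linear (arrow_mx c : V -> E).
Proof.
by case: c => i a x y; rewrite /= /Amx /Bmx !ffunE scale_block_mx add_block_mx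
  !scaler0 !addr0.
Qed.

Lemma letter_linear l : linear (fun m => letter m l).
Proof.
case: l => [|k] a x y; first by rewrite /= scaler0 addr0.
rewrite /letter; case: arrow_nat => [c|] /=; first exact: arrow_mx_linear.
by rewrite scaler0 addr0.
Qed.

Lemma mx_deriveE p q (F : C -> 'M[C]_(p, q)) t D :
  is_mx_derive F t D -> mx_derive F t = D.
Proof.
move=> dF; apply/matrixP => i j; rewrite mxE.
by have [_ <-] := dF i j; rewrite derive1E.
Qed.

Lemma linear_mx_diff (W : lmodType C) p q (F : W -> 'M[C]_(p, q)) (x y : W) :
  linear F -> is_mx_derive (fun t => F (x + t *: y)) 0 (F y).
Proof.
move=> Flin.
have -> : (fun t => F (x + t *: y)) = (fun t => F x + t *: F y).
  by apply/funext => t; rewrite addrC Flin addrC.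
exact: is_mx_derive_affine.
Qed.

Lemma mx_diff_arrow c m v : mx_diff (arrow_mx c) m v = arrow_mx c v.
Proof. exact/mx_deriveE/linear_mx_diff/arrow_mx_linear. Qed.

Local Notation N := (n.*2).
Local Notation shift f := (fun j => f j.+1).

Lemma interleaveE m : interleave (fun i => Amx i m) (fun i => Bmx i m) =
  [seq letter m j.+1 | j <- iota 0 N].
Proof.
rewrite -(map_arrows 0 (fun c => arrow_mx c m)) /interleave map_flatten.
by rewrite -map_comp.
Qed.

Lemma even_double : ~~ odd N.
Proof. by rewrite odd_double. Qed.

Lemma shift_alternating (S : pzRingType) (e : bool -> S) (y : nat -> S) k :
  alternating e y -> alternating_upto (fun b => e (~~ b)) k (shift y).
Proof. by move=> yh l _; rewrite /homog; apply: (yh l.+1). Qed.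

(** The word starts with A_1 at the odd position 1, so the results on words that start at position 0
    are applied with the two idempotents exchanged. *)
Lemma contABE m : contAB m = drsubmx (pprod (shift (letter m)) N).
Proof.
have := continuant_pprod (complementary_idempotentsN vertex_idemP) even_double
  (shift_alternating (k := N) (letter_alternating m)).
rewrite /= !corner_true /contAB interleaveE.
by move=> /(congr1 drsubmx); rewrite !block_mxKdr.
Qed.

Lemma contBAE m : contBA m = ulsubmx (rprod (shift (letter m)) N).
Proof.
have := continuant_rev_pprod (complementary_idempotentsN vertex_idemP)
  even_double (shift_alternating (k := N) (letter_alternating m)).
rewrite /= !corner_false /contBA interleaveE.
by move=> /(congr1 ulsubmx); rewrite !block_mxKul.
Qed.

(** [invAB] and [invBA] are the elements [Phi'] and [Psi'] of [corner_form]: inverses within a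
    corner, extended by zero. *)
Definition invAB m : E := block_mx 0 0 0 (invmx (contAB m)).
Definition invBA m : E := block_mx (invmx (contBA m)) 0 0 0.

Lemma invAB_homog m : homog vertex_idem true true (invAB m).
Proof. by rewrite /homog corner_true block_mxKdr. Qed.

Lemma invBA_homog m : homog vertex_idem false false (invBA m).
Proof. by rewrite /homog corner_false block_mxKul. Qed.

Section Inverses.
Variable m : V.
Hypothesis mM : inM m.

Lemma invABV : invAB m *
  (vertex_idem true * pprod (shift (letter m)) N * vertex_idem true) =
  vertex_idem true.
Proof.
have /andP[ABu _] := mM.
rewrite corner_true -contABE [LHS]mulmx_block.
by rewrite !mulmx0 !mul0mx !addr0 ?add0r mulVmx.
Qed.

Lemma invABVr : vertex_idem true * pprod (shift (letter m)) N
  * vertex_idem true * invAB m = vertex_idem true.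
Proof.
have /andP[ABu _] := mM.
rewrite corner_true -contABE [LHS]mulmx_block.
by rewrite !mulmx0 !mul0mx !addr0 ?add0r mulmxV.
Qed.

Lemma invBAVr : vertex_idem false * rprod (shift (letter m)) N
  * vertex_idem false * invBA m = vertex_idem false.
Proof.
have /andP[_ BAu] := mM.
rewrite corner_false -contBAE [LHS]mulmx_block.
by rewrite !mulmx0 !mul0mx !addr0 ?add0r mulmxV.
Qed.

End Inverses.

Lemma tr_invAB m (M : E) : \tr (invAB m * M) =
  \tr (invmx (contAB m) *m drsubmx M).
Proof.
rewrite -[M in LHS]submxK [X in \tr X]mulmx_block mxtrace_block.
by rewrite !mul0mx !addr0 mxtrace0 !add0r.
Qed.

Lemma tr_invBA m (M : E) : \tr (invBA m * M) =
  \tr (invmx (contBA m) *m ulsubmx M).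
Proof.
rewrite -[M in LHS]submxK [X in \tr X]mulmx_block mxtrace_block.
by rewrite !mul0mx !addr0 mxtrace0 !addr0.
Qed.

Lemma jet_letters_arrow m u v :
  [seq letter_jet (@arrow_mx R n d1 d2) m u v c | c <- interleave inl inr] =
  [seq jet_letters (letter m) (letter u) (letter v) j.+1 | j <- iota 0 N].
Proof.
rewrite (map_arrows (jet 0 0 0 0)); apply: eq_map => k.
rewrite /jet_letters /letter; case: arrow_nat => //= c.
by rewrite /letter_jet !mx_diff_arrow.
Qed.

Lemma arrow_wordE : arrow_word R n =
  [seq ncvar C c | c <- interleave inl inr].
Proof. by rewrite /arrow_word /interleave map_flatten -map_comp. Qed.

Lemma jet_corner_true (A A' : 'M[E]_3) :
  jet_idem vertex_idem true * A * jet_idem vertex_idem true =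
  jet_idem vertex_idem true * A' * jet_idem vertex_idem true ->
  drsubmx (jet_top A) = drsubmx (jet_top A').
Proof.
move=> /(congr1 (@jet_top _)); rewrite !jet_top_idem !corner_true.
by move=> /(congr1 drsubmx); rewrite !block_mxKdr.
Qed.

Lemma jet_corner_false (A A' : 'M[E]_3) :
  jet_idem vertex_idem false * A * jet_idem vertex_idem false =
  jet_idem vertex_idem false * A' * jet_idem vertex_idem false ->
  ulsubmx (jet_top A) = ulsubmx (jet_top A').
Proof.
move=> /(congr1 (@jet_top _)); rewrite !jet_top_idem !corner_false.
by move=> /(congr1 ulsubmx); rewrite !block_mxKul.
Qed.

Section JetCorners.
Variables (m u v : V).
Let J j := jet_letters (letter m) (letter u) (letter v) j.+1.

Lemma jet_continuant :
  drsubmx (jet_top (continuant 1 [seq J j | j <- iota 0 N])) =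
  drsubmx (jet_top (pprod J N)).
Proof.
have Jh := jet_letters_alternating (letter_alternating m)
  (letter_alternating u) (letter_alternating v).
have contE : jet_idem vertex_idem true * continuant 1 [seq J j | j <- iota 0
  N] * jet_idem vertex_idem true =
    jet_idem vertex_idem true * pprod J N * jet_idem vertex_idem true.
  exact: (continuant_pprod (complementary_idempotentsN (jet_idemP vertex_idemP))
    even_double (shift_alternating (k := N) Jh)).
exact: jet_corner_true contE.
Qed.

Lemma jet_continuant_rev :
  ulsubmx (jet_top (continuant 1 (rev [seq J j | j <- iota 0 N]))) =
  ulsubmx (jet_top (rprod J N)).
Proof.
have Jh := jet_letters_alternating (letter_alternating m)
  (letter_alternating u) (letter_alternating v).
have contE : jet_idem vertex_idem false * continuant 1 (rev [seq J j | j <-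
  iota 0 N]) * jet_idem vertex_idem false =
    jet_idem vertex_idem false * rprod J N * jet_idem vertex_idem false.
  exact: (continuant_rev_pprod (complementary_idempotentsN (jet_idemP
    vertex_idemP))
    even_double (shift_alternating (k := N) Jh)).
exact: jet_corner_false contE.
Qed.

End JetCorners.

End Letters.

Lemma tr_corners_linear (K : numFieldType) (p q : nat) (a : K) (P : 'M[K]_p)
    (Q : 'M[K]_q) (A A' B B' : 'M[K]_(p + q)) :
  2^-1 * \tr (P *m ulsubmx (a *: A + A'))
    - 2^-1 * \tr (Q *m drsubmx (a *: B + B')) =
  a * (2^-1 * \tr (P *m ulsubmx A) - 2^-1 * \tr (Q *m drsubmx B))
  + (2^-1 * \tr (P *m ulsubmx A') - 2^-1 * \tr (Q *m drsubmx B')).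
Proof.
have -> : ulsubmx (a *: A + A') = a *: ulsubmx A + ulsubmx A'.
  by apply/matrixP => i j; rewrite !mxE.
have -> : drsubmx (a *: B + B') = a *: drsubmx B + drsubmx B'.
  by apply/matrixP => i j; rewrite !mxE.
rewrite !mulmxDr -!scalemxAr !mxtraceD !mxtraceZ; by ring.
Qed.

(** * The 2-form, Boalch's form and the derivative of the moment map *)

Section Omega.
Variables (R : realType) (n d1 d2 : nat).
Local Notation C := R[i].
Local Notation V := (rep_space R n d1 d2).
Local Notation E := 'M[C]_(d1 + d2).
Local Notation N := (n.*2).
Local Notation shift f := (fun j => f j.+1).
Implicit Types (m u v : V) (c : 'I_n + 'I_n).

Lemma ulsubmxB (A B : E) : ulsubmx (A - B) = ulsubmx A - ulsubmx B.
Proof. by apply/matrixP => i j; rewrite !mxE. Qed.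

Lemma drsubmxB (A B : E) : drsubmx (A - B) = drsubmx A - drsubmx B.
Proof. by apply/matrixP => i j; rewrite !mxE. Qed.

Local Notation J m u v :=
  (fun j => jet_letters (letter m) (letter u) (letter v) j.+1).

Section FormContinuant.
Variables (L : choiceType) (rho : L -> V -> E) (s : seq L) (m : V).
Local Notation jets u v := [seq letter_jet rho m u v x | x <- s].

(** Stated for any alphabet whose jets are those of the letters, so as to serve the arrows and the
    fission coordinates alike. *)
Lemma form_continuant u v :
  (forall u v, jets u v = [seq J m u v j | j <- iota 0 N]) ->
  drsubmx (form2_eval rho (D2 (continuant 1 [seq ncvar C x | x <- s])) m u v) =
  drsubmx (jet_top (pprod (J m u v) N) - jet_top (pprod (J m v u) N)).
Proof.
move=> jetsE; apply: etrans (congr1 _ (form2_eval_continuant _ _ _ _ _)) _.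
have cE a b := etrans
  (congr1 (fun t => drsubmx (jet_top (continuant 1 t))) (jetsE a b))
  (jet_continuant m a b).
apply: etrans (drsubmxB _ _) _.
apply: etrans (congr2 (fun x y => x - y) (cE u v) (cE v u)) _.
exact: esym (drsubmxB _ _).
Qed.

Lemma form_continuant_rev u v :
  (forall u v, jets u v = rev [seq J m u v j | j <- iota 0 N]) ->
  ulsubmx (form2_eval rho (D2 (continuant 1 [seq ncvar C x | x <- s])) m u v) =
  ulsubmx (jet_top (rprod (J m u v) N) - jet_top (rprod (J m v u) N)).
Proof.
move=> jetsE; apply: etrans (congr1 _ (form2_eval_continuant _ _ _ _ _)) _.
have cE a b := etrans
  (congr1 (fun t => ulsubmx (jet_top (continuant 1 t))) (jetsE a b))
  (jet_continuant_rev m a b).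
apply: etrans (ulsubmxB _ _) _.
apply: etrans (congr2 (fun x y => x - y) (cE u v) (cE v u)) _.
exact: esym (ulsubmxB _ _).
Qed.

End FormContinuant.

Lemma corner_form_tr m u v :
  2^-1 * corner_form (@mxtrace C (d1 + d2)) N (letter m) (invAB m) (invBA m)
           (letter u) (letter v) =
  2^-1 * \tr (invmx (contBA m) *m
    ulsubmx (jet_top (rprod (J m u v) N) - jet_top (rprod (J m v u) N)))
  - 2^-1 * \tr (invmx (contAB m) *m
    drsubmx (jet_top (pprod (J m u v) N) - jet_top (pprod (J m v u) N))).
Proof. by rewrite -tr_invBA -tr_invAB -mulrBr. Qed.

Lemma tr_omegaE m u v :
  tr_omega_Rep m u v =
  2^-1 * corner_form (@mxtrace C (d1 + d2)) N (letter m) (invAB m) (invBA m)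
           (letter u) (letter v).
Proof.
have BAE := @form_continuant_rev _ (@arrow_mx R n d1 d2)
  (rev (interleave inl inr)) m u v.
have ABE := @form_continuant _ (@arrow_mx R n d1 d2) (interleave inl inr) m u v.
rewrite corner_form_tr /tr_omega_Rep arrow_wordE -map_rev.
apply: (congr2 (fun A B => 2^-1 * \tr (invmx (contBA m) *m A)
                           - 2^-1 * \tr (invmx (contAB m) *m B))).
  apply: BAE => a b; apply: etrans (map_rev _ _) _.
  exact: congr1 (jet_letters_arrow m a b).
apply: ABE => a b; exact: jet_letters_arrow.
Qed.

Lemma fission_letter m l : (0 < l <= N)%N ->
  fission_mx l m = letter m (N.+1 - l).
Proof.
move=> /andP[l0 lN]; rewrite /fission_mx /Anat /Bnat.
have -> : (N.+1 - l)%N = (N - l).+1 by lia.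
rewrite /letter /arrow_nat oddB // odd_double /=.
case: ifP => lo /=.
  have -> : ((N - l + 1)./2.-1 = (N - l)./2)%N by lia.
  by case: insub.
have -> : ((N - l + 2)./2.-1 = (N - l)./2)%N by lia.
by case: insub.
Qed.

Lemma map_fission (T : Type) (G F : nat -> T) :
  (forall l, (0 < l <= N)%N -> G l = F (N.+1 - l)%N) ->
  [seq G l | l <- iota 1 N] = rev [seq F j.+1 | j <- iota 0 N].
Proof.
move=> GF; rewrite -map_rev.
have -> : rev (iota 0 N) = [seq (N - l)%N | l <- iota 1 N].
  apply: (@eq_from_nth _ 0%N); first by rewrite size_rev size_map !size_iota.
  move=> i; rewrite size_rev size_iota => iN.
  rewrite (nth_map 0%N) ?size_iota // nth_rev ?size_iota // !nth_iota //; lia.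
rewrite -map_comp; apply/eq_in_map => l; rewrite mem_iota => lN /=.
by rewrite GF; [congr F|]; lia.
Qed.

Lemma fission_mx_linear l : linear (@fission_mx R n d1 d2 l).
Proof.
rewrite /fission_mx /Anat /Bnat => a x y; case: ifP => _; case: insub => [i|];
  by [rewrite scaler0 addr0 | apply: (arrow_mx_linear (inl i))
     | apply: (arrow_mx_linear (inr i))].
Qed.

Lemma jet_letters_fission m u v :
  [seq letter_jet (@fission_mx R n d1 d2) m u v l | l <- iota 1 N] =
  rev [seq jet_letters (letter m) (letter u) (letter v) j.+1
      | j <- iota 0 N].
Proof.
apply: map_fission => l lN.
have dF w : mx_diff (@fission_mx R n d1 d2 l) m w = fission_mx l w.
  exact/mx_deriveE/linear_mx_diff/fission_mx_linear.
by rewrite /letter_jet !dF !fission_letter.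
Qed.

Lemma tr_omega_boalch m u v : tr_omega_Rep m u v = boalch_form m u v.
Proof.
rewrite tr_omegaE corner_form_tr /boalch_form.
have -> : [seq fission_mx l m | l <- iota 1 N] =
    rev (interleave (fun i => Amx i m) (fun i => Bmx i m)).
  by rewrite interleaveE; apply: map_fission => l; apply: fission_letter.
rewrite revK -/(contAB m) -/(contBA m) /fission_word.
have BAE := @form_continuant_rev _ (@fission_mx R n d1 d2) (iota 1 N) m u v.
have ABE := @form_continuant _ (@fission_mx R n d1 d2) (rev (iota 1 N)) m u v.
rewrite -map_rev; apply: esym.
apply: (congr2 (fun A B => 2^-1 * \tr (invmx (contBA m) *m A)
                           - 2^-1 * \tr (invmx (contAB m) *m B))).
  by apply: BAE => a b; apply: jet_letters_fission.
apply: ABE => a b; apply: etrans (map_rev _ _) _.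
apply: etrans (congr1 rev (jet_letters_fission m a b)) _; exact: revK.
Qed.

Lemma tr_omega_linear m u : linear (tr_omega_Rep m u : V -> C^o).
Proof.
move=> a x y; rewrite /tr_omega_Rep.
have dl c : linear (mx_diff (@arrow_mx R n d1 d2 c) m).
  by move=> b z w; rewrite !mx_diff_arrow; apply: arrow_mx_linear.
apply: etrans _ (tr_corners_linear _ _ _ _ _ _ _).
exact: (congr2 (fun A B => 2^-1 * \tr (invmx (contBA m) *m ulsubmx A)
                         - 2^-1 * \tr (invmx (contAB m) *m drsubmx B))
  (form2_eval_linear dl _ u a x y) (form2_eval_linear dl _ u a x y)).
Qed.

Lemma letter_line m v l t :
  letter (m + t *: v) l = letter m l + t *: letter v l.
Proof. by rewrite addrC letter_linear addrC. Qed.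

Lemma is_mx_derive_letter m v l :
  is_mx_derive (fun t => letter (m + t *: v) l) 0 (letter v l).
Proof.
have -> : (fun t => letter (m + t *: v) l) =
    (fun t => letter m l + t *: letter v l).
  by apply/funext => t; rewrite letter_line.
exact: is_mx_derive_affine.
Qed.

Lemma is_mx_derive_contAB m v :
  is_mx_derive (fun t => contAB (m + t *: v)) 0
    (drsubmx (dpprod (shift (letter m)) (shift (letter v)) N)).
Proof.
have -> : (fun t => contAB (m + t *: v)) =
    (fun t => drsubmx (pprod (fun j => letter (m + t *: v) j.+1) N)).
  by apply/funext => t; rewrite contABE.
have dp := is_mx_derive_pprod N (fun j => is_mx_derive_letter m v j.+1).
move=> i j; under eq_fun do rewrite !mxE; rewrite !mxE.
have := dp (rshift d1 i) (rshift d1 j).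
by rewrite scale0r addr0.
Qed.

Lemma is_mx_derive_contBA m v :
  is_mx_derive (fun t => contBA (m + t *: v)) 0
    (ulsubmx (drprod (shift (letter m)) (shift (letter v)) N)).
Proof.
have -> : (fun t => contBA (m + t *: v)) =
    (fun t => ulsubmx (rprod (fun j => letter (m + t *: v) j.+1) N)).
  by apply/funext => t; rewrite contBAE.
have dp := is_mx_derive_rprod N (fun j => is_mx_derive_letter m v j.+1).
move=> i j; under eq_fun do rewrite !mxE; rewrite !mxE.
have := dp (lshift d2 i) (lshift d2 j).
by rewrite scale0r addr0.
Qed.

(** The matrices [X m] are known only for m in M, so differentiating their entries along a line
    requires that the line stay in M for small t. *)
Lemma near_inM m v : inM m -> \forall t \near (0 : C^o), inM (m + t *: v).
Proof.
move=> /andP[ABu BAu].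
have m0 : m + (0 : C) *: v = m by rewrite scale0r addr0.
have := near_unitmx (is_mx_derive_contAB m v).
rewrite m0 => /(_ ABu) nearAB.
have := near_unitmx (is_mx_derive_contBA m v).
rewrite m0 => /(_ BAu) nearBA.
near=> t; apply/andP; split; near: t; [exact: nearAB | exact: nearBA].
Unshelve. all: by end_near. Qed.

(** The right-hand side is the element [D] of [corner_form_hamiltonian]. *)
Lemma dmomentE m v : inM m ->
  block_mx (dmoment m v).1 0 0 (dmoment m v).2 =
  vertex_idem R d1 d2 true * dpprod (shift (letter m)) (shift (letter v)) N
    * vertex_idem R d1 d2 true
  - invBA m * drprod (shift (letter m)) (shift (letter v)) N * invBA m.
Proof.
move=> /andP[ABu BAu].
have m0 : m + (0 : C) *: v = m by rewrite scale0r addr0.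
have d1E : (dmoment m v).1 = - (invmx (contBA m)
    *m ulsubmx (drprod (shift (letter m)) (shift (letter v)) N)
    *m invmx (contBA m)).
  have := is_mx_deriveV (is_mx_derive_contBA m v).
  by rewrite m0 => /(_ BAu) /mx_deriveE.
have d2E : (dmoment m v).2 =
    drsubmx (dpprod (shift (letter m)) (shift (letter v)) N).
  exact/mx_deriveE/is_mx_derive_contAB.
apply: etrans (congr2 (fun x y => block_mx x 0 0 y) d1E d2E) _.
apply: etrans _ (congr1 (fun x => x - _) (esym (corner_true _))).
set D := drprod _ _ _.
have -> : invBA m * D * invBA m =
    block_mx (invmx (contBA m) *m ulsubmx D *m invmx (contBA m)) 0 0 0.
  rewrite -[D in LHS]submxK /invBA [X in X * _]mulmx_block [LHS]mulmx_block.
  by rewrite !mulmx0 !mul0mx !addr0 ?mul0mx.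
by rewrite opp_block_mx add_block_mx !oppr0 !addr0 !add0r.
Qed.

End Omega.

(** * Fundamental vector fields *)

Section FundamentalField.
Variables (R : realType) (n d1 d2 : nat).
Local Notation C := R[i].
Local Notation V := (rep_space R n d1 d2).
Implicit Types (m : V) (c : 'I_n + 'I_n) (xi : lieH R d1 d2).

Definition lie_mx xi : 'M[C]_(d1 + d2) := block_mx xi.1 0 0 xi.2.

Lemma lie_mx_linear : linear lie_mx.
Proof.
by move=> a x y; rewrite /lie_mx scale_block_mx add_block_mx !scaler0 !addr0.
Qed.

Lemma is_mx_derive_conj p q (X : 'M[C]_p) (Y : 'M[C]_q) (A : 'M[C]_(p, q)) :
  is_mx_derive
    (fun t => expmx (- t *: X) *m A *m invmx (expmx (- t *: Y))) 0
    (- (X *m A - A *m Y)).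
Proof.
have dE r (Z : 'M[C]_r) : is_mx_derive (fun t => expmx (- t *: Z)) 0 (- Z).
  have -> : (fun t => expmx (- t *: Z)) = (fun t => expmx (t *: - Z)).
    by apply/funext => t; rewrite scaleNr scalerN.
  exact: is_mx_derive_expmx.
have E0 r (Z : 'M[C]_r) : expmx (- (0 : C) *: Z) = 1%:M.
  by rewrite oppr0 scale0r expmx0.
have dV : is_mx_derive (fun t => invmx (expmx (- t *: Y))) 0 Y.
  have := is_mx_deriveV (dE _ Y); rewrite E0 unitmx1 => /(_ isT).
  by rewrite invmx1 mul1mx mulmx1 opprK.
have := is_mx_deriveM (is_mx_deriveM (dE _ X) (is_mx_derive_cst _ A)) dV.
rewrite !E0 invmx1 mulmx0 addr0 mulmx1 mul1mx mulNmx.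
by rewrite opprB addrC.
Qed.

Lemma fundamental_arrow xi m c :
  arrow_mx c (fundamental_field xi m) =
  - (lie_mx xi *m arrow_mx c m - arrow_mx c m *m lie_mx xi).
Proof.
case: c => i; rewrite /= /Amx /Bmx /lie_mx !ffunE !mulmx_block.
  rewrite (mx_deriveE (D := - (xi.2 *m m.1 i - m.1 i *m xi.1))); last first.
    under eq_fun do rewrite /exp_flow /act /= ffunE.
    exact: is_mx_derive_conj.
  rewrite !mulmx0 !mul0mx !addr0 !add0r opp_block_mx add_block_mx.
  by rewrite opp_block_mx !oppr0 !addr0 !oppr0.
rewrite (mx_deriveE (D := - (xi.1 *m m.2 i - m.2 i *m xi.2))); last first.
  under eq_fun do rewrite /exp_flow /act /= ffunE.
  exact: is_mx_derive_conj.
rewrite !mulmx0 !mul0mx !addr0 !add0r opp_block_mx add_block_mx.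
by rewrite opp_block_mx !oppr0 !addr0 !oppr0.
Qed.

End FundamentalField.

(** * Matrix entries as covectors *)

Section Coordinates.
Variables (R : realType) (n d1 d2 : nat).
Local Notation C := R[i].
Local Notation V := (rep_space R n d1 d2).
Local Notation dual := 'Hom(V, C^o).
Implicit Types (m v : V) (c : 'I_n + 'I_n).

Definition coord_fun c (i j : 'I_(d1 + d2)) (v : V) : C^o := arrow_mx c v i j.

Lemma coord_fun_linear c i j : linear (coord_fun c i j).
Proof.
by move=> a x y; rewrite /coord_fun arrow_mx_linear mxE [in X in X + _]mxE.
Qed.

HB.instance Definition _ c i j :=
  GRing.isLinear.Build C V C^o _ (coord_fun c i j) (coord_fun_linear c i j).

Definition coord_dual c i j : dual := linfun (coord_fun c i j).

Lemma coord_dualE c i j v : coord_dual c i j v = arrow_mx c v i j.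
Proof. by rewrite lfunE. Qed.

(** The (i, j) entry of the letter y is tr (E_ji y); the condition places the matrix unit E_ji in
    the block required of W in [ham]. *)
Definition in_block c (i j : 'I_(d1 + d2)) : Prop :=
  vertex_idem R d1 d2 (odd (arrow_pos c).+1) * delta_mx j i
    * vertex_idem R d1 d2 (odd (arrow_pos c)) = delta_mx j i.

(** The entries of the letters within their own blocks span the dual space. *)
Lemma dual_ind (Q : dual -> Prop) :
  Q 0 -> (forall a x y, Q x -> Q y -> Q (a *: x + y)) ->
  (forall c i j, in_block c i j -> Q (coord_dual c i j)) ->
  forall be, Q be.
Proof.
move=> Q0 QP Qc be.
have Qsum (I : finType) (F : I -> dual) : (forall i, Q (F i)) -> Q (\sum_i F i).
  move=> QF; elim/big_ind: _ => // x y Qx Qy.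
  by rewrite -[x]scale1r; apply: QP.
have QZ a x : Q x -> Q (a *: x) by move=> Qx; rewrite -[_ *: _]addr0; apply: QP.
pose inA i (M : 'M[C]_(d2, d1)) : V :=
  ([ffun k => if k == i then M else 0], 0).
pose inB i (M : 'M[C]_(d1, d2)) : V :=
  (0, [ffun k => if k == i then M else 0]).
have inA_lin i : linear (inA i).
  move=> a x y; congr pair; last by rewrite /= scaler0 addr0.
  by apply/ffunP => k; rewrite !ffunE; case: eqP; rewrite // scaler0 addr0.
have inB_lin i : linear (inB i).
  move=> a x y; congr pair; first by rewrite /= scaler0 addr0.
  by apply/ffunP => k; rewrite !ffunE; case: eqP; rewrite // scaler0 addr0.
have beA i (M : 'M[C]_(d2, d1)) : be (inA i M) =
    \sum_p \sum_q M p q * be (inA i (delta_mx p q)).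
  pose G : {linear 'M[C]_(d2, d1) -> C^o} :=
    HB.pack (fun M => be (inA i M) : C^o) (GRing.isLinear.Build C _ _ _ _
      (fun a x y => etrans (congr1 be (inA_lin i a x y)) (linearP be a _ _))).
  rewrite -[LHS]/(G M) {1}(matrix_sum_delta M) linear_sum.
  apply: eq_bigr => p _; rewrite linear_sum; apply: eq_bigr => q _.
  by rewrite linearZ.
have beB i (M : 'M[C]_(d1, d2)) : be (inB i M) =
    \sum_p \sum_q M p q * be (inB i (delta_mx p q)).
  pose G : {linear 'M[C]_(d1, d2) -> C^o} :=
    HB.pack (fun M => be (inB i M) : C^o) (GRing.isLinear.Build C _ _ _ _
      (fun a x y => etrans (congr1 be (inB_lin i a x y)) (linearP be a _ _))).
  rewrite -[LHS]/(G M) {1}(matrix_sum_delta M) linear_sum.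
  apply: eq_bigr => p _; rewrite linear_sum; apply: eq_bigr => q _.
  by rewrite linearZ.
have sumA (v : V) : v = \sum_i inA i (v.1 i) + \sum_i inB i (v.2 i).
  rewrite [LHS]surjective_pairing [RHS]surjective_pairing; congr pair.
    rewrite raddfD !raddf_sum /= [X in _ + X]big1 // addr0.
    apply/ffunP => k; rewrite sum_ffunE (bigD1 k) //= ffunE eqxx.
    by rewrite big1 ?addr0 // => l lk; rewrite ffunE eq_sym (negbTE lk).
  rewrite raddfD !raddf_sum /= [X in X + _]big1 // add0r.
  apply/ffunP => k; rewrite sum_ffunE (bigD1 k) //= ffunE eqxx.
  by rewrite big1 ?addr0 // => l lk; rewrite ffunE eq_sym (negbTE lk).
have -> : be =
  \sum_i \sum_p \sum_q be (inA i (delta_mx p q))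
     *: coord_dual (inl i) (rshift d1 p) (lshift d2 q)
  + \sum_i \sum_p \sum_q be (inB i (delta_mx p q))
     *: coord_dual (inr i) (lshift d2 p) (rshift d1 q).
  apply/lfunP => v; rewrite {1}(sumA v) linearD !linear_sum add_lfunE.
  rewrite !sum_lfunE; congr (_ + _); apply: eq_bigr => i _.
    apply: etrans (beA _ _) _; rewrite sum_lfunE; apply: eq_bigr => p _.
    rewrite sum_lfunE; apply: eq_bigr => q _.
    by rewrite scale_lfunE coord_dualE block_mxEdl mulrC.
  apply: etrans (beB _ _) _; rewrite sum_lfunE; apply: eq_bigr => p _.
  rewrite sum_lfunE; apply: eq_bigr => q _.
  by rewrite scale_lfunE coord_dualE block_mxEur mulrC.
rewrite -[X in X + _]scale1r; apply: QP;
  apply: (Qsum) => i; apply: (Qsum) => p; apply: (Qsum) => q;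
  apply/QZ/Qc; rewrite /in_block /= odd_double.
  rewrite delta_mx_ushift delta_mx_rshift -(row_mx0 _ _ d1 d2).
  exact: homog_block_ur.
rewrite delta_mx_dshift delta_mx_lshift -(row_mx0 _ _ d1 d2).
exact: homog_block_dl.
Qed.

End Coordinates.

(** * The double bracket as a Hamiltonian variation *)

Section HamiltonianCases.
Variables (S : pzRingType) (e : bool -> S).
Hypothesis eP : complementary_idempotents e.
Variable y : nat -> S.
Hypothesis yalt : alternating e y.
Variables (k l : nat) (W Q : S).
Hypothesis Wh : homog e (~~ odd k) (odd k) W.
Hypothesis QE : Q = W * y k - y k * W.

(** Here y_k y_l = y_l y_k = 0, which leaves in the commutator of Q with y_l the two terms of the
    brackets of a with a and of b with b. *)
Lemma ham_same_parity : odd l = odd k ->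
  let Z := y k * W * y l + y l * W * y k in
  ham y k W Q l = if (l < k)%N then Z else if l == k then 0 else - Z.
Proof.
move=> lk Z; rewrite /ham.
have -> : (l == k.+1) = false by apply/eqP => lE; move: lk; rewrite lE /=;
  case: odd.
have -> : (l.+1 == k) = false by apply/eqP => lE; move: lk; rewrite -lE /=;
  case: odd.
rewrite addr0 subr0.
have yl : homog e (odd k) (~~ odd k) (y l) by rewrite -lk; apply: yalt.
have kl0 : y k * y l = 0 by apply: (homogM0 eP (yalt k) (y := y l)); rewrite
  negbK; apply: yl.
have lk0 : y l * y k = 0 by apply: (homogM0 eP yl (y := y k)); rewrite negbK;
  apply: yalt.
have -> : Q * y l - y l * Q = - Z.
  rewrite QE mulrBl mulrBr !mulrA -(mulrA W) kl0 lk0 mulr0 mul0r sub0r opprB.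
  by rewrite sub0r -opprD.
by rewrite opprK.
Qed.

(** Here W y_l = y_l W = 0, which leaves the two terms of the brackets between a and b. *)
Lemma ham_opposite_parity : odd l = ~~ odd k ->
  let Z := W * y k * y l + y l * y k * W in
  ham y k W Q l = (if (l < k)%N then - Z else Z)
    + (if l == k.+1 then W + W else 0) - (if l.+1 == k then W + W else 0).
Proof.
move=> lk Z; rewrite /ham.
have -> : (l == k) = false by apply/eqP => lE; move: lk; rewrite lE /=; case:
  odd.
have yl : homog e (~~ odd k) (odd k) (y l).
  by rewrite -[X in homog e _ X]negbK -lk; apply: yalt.
have Wl0 : W * y l = 0 by apply: (homogM0 eP Wh yl).
have lW0 : y l * W = 0 by apply: (homogM0 eP yl Wh).
have -> // : Q * y l - y l * Q = Z.
by rewrite QE mulrBl mulrBr !mulrA lW0 mul0r sub0r opprK -(mulrA _ W) Wl0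
  mulr0 subr0.
Qed.

End HamiltonianCases.

Section Brackets.
Variables (R : realType) (n d1 d2 : nat).
Local Notation C := R[i].
Local Notation V := (rep_space R n d1 d2).
Local Notation E := 'M[C]_(d1 + d2).
Variables (B : algType C) (e1 e2 : B) (a b : 'I_n -> B).
Variables (T : lmodType C) (tens dbr : B -> B -> T).
Hypothesis tensP : is_bilinear tens.
Hypothesis dbrP : is_double_bracket tens dbr e1 e2.
Hypothesis dbrE : gamma_bracket_values tens dbr e1 e2 a b.
Variables (m : V) (X : B -> E).
Hypothesis XP : is_representation e1 e2 a b m X.

Definition arrow_elt (c : 'I_n + 'I_n) : B :=
  match c with inl i => a i | inr i => b i end.

Lemma tens_scale k x y : tens (k *: x) y = k *: tens x y.
Proof. exact: (GRing.scalable_linear (tensP.1 y)). Qed.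

Lemma tens_scale_r k x y : tens x (k *: y) = k *: tens x y.
Proof. exact: (GRing.scalable_linear (tensP.2 x)). Qed.

Lemma X_scale k x : X (k *: x) = k *: X x.
Proof. by case: XP => Xl _ _ _ _; exact: (GRing.scalable_linear Xl). Qed.

Lemma X_mul x y : X (x * y) = X x * X y.
Proof. by case: XP => _ XM _ _ _; apply: XM. Qed.

Lemma X_idem : X e1 = vertex_idem R d1 d2 false /\ X e2 = vertex_idem R d1 d2
  true.
Proof. by case: XP => _ _ _ []. Qed.

Lemma X_arrow c : X (arrow_elt c) = arrow_mx c m.
Proof. by case: XP => _ _ _ _ Xab; case: c => i; have [] := Xab i. Qed.

(* The coefficient of the Hamiltonian vector field of tr (D X) at y, when
   dbr x y is the sum of the pure tensors in s. *)
Definition tens_action (D : E) (s : seq (B * B)) : E :=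
  \sum_(p <- s) X p.1 * D * X p.2.

(** The neighbours of a_i in the word are b_i on its right and b_{i-1} on its left: these are the
    letters whose bracket with a_i has a constant term, with opposite signs. The order of the
    letters in the word gives the signs of the other terms. *)
Lemma arrow_bracket c c' D :
  homog (vertex_idem R d1 d2) (~~ odd (arrow_pos c)) (odd (arrow_pos c)) D ->
  let W := 2^-1 *: D in
  let Q := W * letter m (arrow_pos c) - letter m (arrow_pos c) * W in
  exists s, dbr (arrow_elt c) (arrow_elt c') = tens_sum tens s /\
    tens_action D s = ham (letter m) (arrow_pos c) W Q (arrow_pos c').
Proof.
move=> Dh W Q.
have eP := vertex_idemP R d1 d2.
have scaleAl (k : C) (A A' : E) : k *: A * A' = k *: (A * A').
  by apply: esym; apply: scalemxAl.
have scaleAr (k : C) (A A' : E) : A * (k *: A') = k *: (A * A').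
  by apply: esym; apply: scalemxAr.
have WW : W + W = D.
  by rewrite /W -scalerDl -[2^-1]mul1r -splitr scale1r.
have Wh : homog (vertex_idem R d1 d2) (~~ odd (arrow_pos c)) (odd (arrow_pos
  c)) W.
  by rewrite /homog scaleAr scaleAl Dh.
have [dAA dBB dAB] := dbrE.
have [_ dbrN _ _] := dbrP.
have ya := letter_alternating m.
have same := @ham_same_parity _ _ eP _ ya (arrow_pos c) (arrow_pos c') W Q
  erefl.
have opp := @ham_opposite_parity _ _ eP _ ya (arrow_pos c) (arrow_pos c') W Q
  Wh erefl.
pose Y := arrow_mx c m; pose Y' := arrow_mx c' m.
rewrite !letter_pos -/Y -/Y' in same opp.
pose S := Y * D * Y' + Y' * D * Y.
pose U := D * Y * Y' + Y' * Y * D.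
have sameE : Y * W * Y' + Y' * W * Y = 2^-1 *: S.
  by rewrite scalerDr /W !scaleAr !scaleAl.
have oppE : W * Y * Y' + Y' * Y * W = 2^-1 *: U.
  by rewrite scalerDr /W !scaleAr !scaleAl.
rewrite sameE in same; rewrite oppE WW in opp.
have actS (k : C) : tens_action D
    [:: (k *: arrow_elt c, arrow_elt c'); (k *: arrow_elt c', arrow_elt c)] =
    k *: S.
  rewrite /tens_action !big_cons big_nil addr0 /= !X_scale !X_arrow -/Y -/Y'.
  by rewrite !scaleAl -scalerDr.
have sumS (k : C) : tens_sum tens
    [:: (k *: arrow_elt c, arrow_elt c'); (k *: arrow_elt c', arrow_elt c)] =
    k *: (tens (arrow_elt c) (arrow_elt c') + tens (arrow_elt c') (arrow_elt
      c)).
  by rewrite /tens_sum !big_cons big_nil addr0 /= !tens_scale scalerDr.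
have [Xe1 Xe2] := X_idem.
have XX c1 c2 : X (arrow_elt c1 * arrow_elt c2) = arrow_mx c1 m * arrow_mx c2 m.
  by rewrite X_mul !X_arrow.
(* [k1] is the coefficient of the two quadratic terms in the bracket of a_i with b_j, and [k2] that
   of the constant term. *)
pose k1 (i j : 'I_n) : C := if (i <= j)%N then 2^-1 else - 2^-1.
pose k2 (i j : 'I_n) : C := if (i < j)%N then 0 else if i == j then 1
  else - ((i - j)%N == 1%N)%:R.
have dAB' i j : dbr (a i) (b j) = tens_sum tens
    [:: (k1 i j *: e1, a i * b j); (k1 i j *: (b j * a i), e2);
        (k2 i j *: e1, e2)].
  rewrite dAB /tens_sum !big_cons big_nil addr0 /= !tens_scale addrA -scalerDr.
  rewrite /k1 /k2 -val_eqE /=; case: ltngtP => _.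
  - by rewrite scale0r addr0.
  - by rewrite !scaleNr.
  - by rewrite scale1r.
case: c c' => [i|i] [j|j] in Q Dh Wh Y Y' S U sameE oppE same opp actS sumS *.
- exists [:: (2^-1 * (if (i < j)%N then -1 else if i == j then 0 else 1) *: a
  i, a j);
             (2^-1 * (if (i < j)%N then -1 else if i == j then 0 else 1) *: a
               j, a i)].
  split; first by rewrite sumS dAA.
  rewrite actS same /= ?odd_double // !ltnS ltn_double eqSS.
  rewrite -val_eqE /= (inj_eq double_inj).
  by case: ltngtP => _; rewrite ?mulr0 ?mulr1 ?mulrN1 ?scale0r ?scaleNr.
- exists [:: (k1 i j *: e1, a i * b j); (k1 i j *: (b j * a i), e2);
             (k2 i j *: e1, e2)]; split; first exact: dAB'.
  have oi : odd (arrow_pos (inl i)) = true by rewrite /= odd_double.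
  have Dl : vertex_idem R d1 d2 false * D = D.
    by move: (homog_l eP Dh); rewrite oi.
  have Dr : D * vertex_idem R d1 d2 true = D.
    by move: (homog_r eP Dh); rewrite oi.
  rewrite opp; last by rewrite oi /= odd_double.
  rewrite /tens_action !big_cons big_nil addr0 /= !X_scale Xe1 Xe2.
  rewrite (XX (inl i) (inr j)) (XX (inr j) (inl i)) -/Y -/Y'.
  rewrite !scaleAl Dl -[Y' * Y * D * _]mulrA Dr addrA -scalerDr mulrA -/U.
  rewrite !eqSS (inj_eq double_inj) /k1 /k2 -val_eqE /=.
  have -> : (j.*2.+2 < i.*2.+1)%N = (j < i)%N by lia.
  have -> : (j.*2.+2 == i.*2)%N = (i == j.+1 :> nat) by lia.
  case: (ltngtP i j) => ij.
  + have -> : (i == j.+1 :> nat) = false by lia.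
    by rewrite scale0r addr0 subr0.
  + have -> : ((i - j)%N == 1%N) = (i == j.+1 :> nat) by lia.
    by rewrite addr0 scaleNr; case: eqP; rewrite ?scaleN1r ?oppr0 ?scale0r
      ?scaleNr ?scale1r.
  + have -> : (i == j.+1 :> nat) = false by lia.
    by rewrite scale1r subr0.
- exists [:: (- k1 j i *: (a j * b i), e1); (- k1 j i *: e2, b i * a j);
             (- k2 j i *: e2, e1)]; split.
    (* The bracket of b_i with a_j comes from that of a_j with b_i by antisymmetry, with the tensor
       factors exchanged. *)
    rewrite (dbrN _ _ _ (dAB' j i)) /tens_sum !big_cons !big_nil !addr0 /=.
    by rewrite !tens_scale !tens_scale_r !opprD !scaleNr.
  have oi : odd (arrow_pos (inr i)) = false by rewrite /= odd_double.
  have Dl : vertex_idem R d1 d2 true * D = D.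
    by move: (homog_l eP Dh); rewrite oi.
  have Dr : D * vertex_idem R d1 d2 false = D.
    by move: (homog_r eP Dh); rewrite oi.
  rewrite opp; last by rewrite oi /= odd_double.
  rewrite /tens_action !big_cons big_nil addr0 /= !X_scale Xe1 Xe2.
  rewrite (XX (inl j) (inr i)) (XX (inr i) (inl j)) -/Y -/Y'.
  rewrite !scaleAl Dl -[Y' * Y * D * _]mulrA Dr addrA -scalerDr mulrA.
  rewrite [X in - k1 j i *: X]addrC -/U.
  rewrite !eqSS (inj_eq double_inj) /k1 /k2 -val_eqE /=.
  have -> : (j.*2.+1 < i.*2.+2)%N = (j <= i)%N by lia.
  have -> : (j.*2 == i.*2.+2)%N = (j == i.+1 :> nat) by lia.
  case: (ltngtP j i) => ij.
  + have -> : (j == i.+1 :> nat) = false by lia.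
    by rewrite oppr0 scale0r addr0 subr0 scaleNr addr0.
  + have -> : ((j - i)%N == 1%N) = (j == i.+1 :> nat) by lia.
    by rewrite subr0 !opprK; case: eqP; rewrite ?scale1r ?scale0r.
  + have -> : (j == i.+1 :> nat) = false by lia.
    by rewrite !scaleNr scale1r addr0.
- exists [:: (2^-1 * (if (i < j)%N then -1 else if i == j then 0 else 1) *: b
  i, b j);
             (2^-1 * (if (i < j)%N then -1 else if i == j then 0 else 1) *: b
               j, b i)].
  split; first by rewrite sumS dBB.
  rewrite actS same /= ?odd_double // !ltnS ltn_double !eqSS.
  rewrite -val_eqE /= (inj_eq double_inj).
  by case: ltngtP => _; rewrite ?mulr0 ?mulr1 ?mulrN1 ?scale0r ?scaleNr.
Qed.

End Brackets.

(** Cyclicity moves the commutator with Y from W to L. Here 2 W is the matrix unit of the tested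
    entry and L will be the difference of the two Maurer-Cartan forms, which is how 1/4 arises. *)
Lemma tr_commutator_identity (K : numFieldType) (p : nat) (W Y L M : 'M[K]_p) :
  2^-1 * \tr ((W *m Y - Y *m W) *m (- L)) + 2 * \tr (W *m M) =
  \tr ((2 *: W) *m (M + 4^-1 *: (L *m Y - Y *m L))).
Proof.
have trN (A : 'M[K]_p) : \tr (- A) = - \tr A by exact: raddfN.
rewrite mulmxDr mxtraceD -!scalemxAl -scalemxAr !mxtraceZ mulmxN trN.
rewrite mulmxBr mulmxBl !mulmxA !mxtraceD !trN (mxtrace_mulC (W *m L)) mulmxA.
by field.
Qed.

(** * The correspondence of the 2-form with the bivector *)

Section Correspondence.
Variables (R : realType) (n d1 d2 : nat).
Local Notation C := R[i].
Local Notation V := (rep_space R n d1 d2).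
Local Notation E := 'M[C]_(d1 + d2).
Local Notation dual := 'Hom(V, C^o).
Local Notation N := (n.*2).
Local Notation ee := (vertex_idem R d1 d2).
Implicit Types (m u v : V) (c : 'I_n + 'I_n).

Lemma mxtrace_delta (i j : 'I_(d1 + d2)) (M : E) :
  \tr (delta_mx j i * M) = M i j.
Proof.
rewrite /mxtrace (bigD1 j) //= mxE (bigD1 i) //= mxE !eqxx mul1r.
rewrite [X in _ + X + _]big1 ?[X in _ + X]big1 ?addr0 //.
- by move=> k kj; rewrite mxE big1 // => l _; rewrite mxE (negbTE kj) mul0r.
- by move=> k ki; rewrite mxE (negbTE ki) andbF mul0r.
Qed.

(** Inserting E_ji between the factors of a pure tensor reproduces the index convention of the
    induced bivector. *)
Lemma mul_delta_entry (M M' : E) (i j k l : 'I_(d1 + d2)) :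
  (M * delta_mx j i * M') k l = M k j * M' i l.
Proof.
rewrite mxE (bigD1 i) //= mxE (bigD1 j) //= mxE !eqxx mulr1.
rewrite [X in _ + X]big1 ?[X in (_ + X) * _]big1 ?addr0 //.
- by move=> p pj; rewrite mxE (negbTE pj) mulr0.
- move=> p pi; rewrite mxE big1 ?mul0r // => q _.
  by rewrite mxE (negbTE pi) andbF mulr0.
Qed.

Lemma letters_vector (H : nat -> E) : alternating ee H ->
  exists v, forall c, arrow_mx c v = H (arrow_pos c).
Proof.
move=> Hh.
exists ([ffun i => dlsubmx (H (arrow_pos (inl i)))],
        [ffun i => ursubmx (H (arrow_pos (inr i)))]).
case=> i; rewrite /= /Amx /Bmx ffunE -[RHS]Hh /= odd_double.
  rewrite -[X in _ * X * _]submxK /vertex_idem.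
  rewrite [X in X * _]mulmx_block [RHS]mulmx_block.
  by rewrite !mulmx0 !mul0mx !mulmx1 !mul1mx !addr0 !add0r ?mul0mx.
rewrite -[X in _ * X * _]submxK /vertex_idem.
rewrite [X in X * _]mulmx_block [RHS]mulmx_block.
by rewrite !mulmx0 !mul0mx !mulmx1 !mul1mx !addr0 !add0r ?mul0mx.
Qed.

Lemma arrow_pos_surj l : (l < N)%N -> exists c, arrow_pos c = l.+1.
Proof.
move=> lN; have hl : (l./2 < n)%N by lia.
case: (boolP (odd l)) => lo.
  by exists (inr (Ordinal hl)) => /=; congr S; lia.
by exists (inl (Ordinal hl)) => /=; congr S; lia.
Qed.

Lemma arrow_mx_sum (I : finType) (k : I -> C) (x : I -> V) c :
  arrow_mx c (\sum_i k i *: x i) = \sum_i k i *: arrow_mx c (x i).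
Proof.
elim/big_rec2: _ => [|i y1 y2 _ <-]; last exact: arrow_mx_linear.
by case: c => i; rewrite /= /Amx /Bmx ffunE block_mx0.
Qed.

Lemma lie_mx_sum (I : finType) (k : I -> C) (x : I -> lieH R d1 d2) :
  lie_mx (\sum_i k i *: x i) = \sum_i k i *: lie_mx (x i).
Proof.
elim/big_rec2: _ => [|i y1 y2 _ <-]; last exact: lie_mx_linear.
by rewrite /lie_mx block_mx0.
Qed.

Section Point.
Variables (m : V) (mM : inM m).

Definition moment_inv : E := block_mx (contBA m) 0 0 (invmx (contAB m)).
Definition dmoment_mx v : E := block_mx (dmoment m v).1 0 0 (dmoment m v).2.

Lemma lie_thetaL v : lie_mx (mu_thetaL m v) = moment_inv * dmoment_mx v.
Proof.
rewrite /lie_mx /mu_thetaL /moment_inv /dmoment_mx [RHS]mulmx_block.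
by rewrite /= invmxK !mulmx0 !mul0mx !addr0 !add0r.
Qed.

Lemma lie_thetaR v : lie_mx (mu_thetaR m v) = dmoment_mx v * moment_inv.
Proof.
rewrite /lie_mx /mu_thetaR /moment_inv /dmoment_mx [RHS]mulmx_block.
by rewrite /= invmxK !mulmx0 !mul0mx !addr0 !add0r.
Qed.

Lemma omega_hamiltonian v x c W :
  homog ee (~~ odd (arrow_pos c)) (odd (arrow_pos c)) W ->
  let Q := W * arrow_mx c m - arrow_mx c m * W in
  (forall c', arrow_mx c' x = ham (letter m) (arrow_pos c) W Q (arrow_pos c'))
    ->
  - tr_omega_Rep m v x =
  2^-1 * \tr (Q * (dmoment_mx v * moment_inv - moment_inv * dmoment_mx v))
  + 2 * \tr (W * arrow_mx c v).
Proof.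
move=> Wh Q xham; rewrite tr_omegaE.
(* Agreement is claimed at positions 1 to 2n only: at position 0, for instance, [ham] contains the
   term - (W + W) when k = 1, whereas the letter is 0. *)
have xl j : (j < N)%N -> letter x j.+1 = ham (letter m) (arrow_pos c) W Q j.+1.
  by move=> /arrow_pos_surj[c' <-]; rewrite letter_pos xham.
have QE : Q = W * letter m (arrow_pos c) - letter m (arrow_pos c) * W.
  by rewrite letter_pos.
rewrite (corner_form_eqr _ _ _ _ _ xl).
have key := corner_form_hamiltonian (tr := @mxtrace C (d1 + d2))
  (@mxtrace_mulC _ _ _) (vertex_idemP R d1 d2) (even_double n)
  (letter_alternating m) (invAB_homog m) (invABV mM) (invABVr mM)
  (invBA_homog m) (invBAVr mM) (letter_alternating v) (arrow_pos_bound c) Wh QE.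
have hE : moment_inv =
  invAB m + ee false * rprod (fun j => letter m j.+1) N * ee false.
  rewrite corner_false -contBAE /invAB /moment_inv add_block_mx.
  by rewrite !addr0 !add0r.
rewrite key letter_pos -hE -(dmomentE v mM) -/(dmoment_mx v).
rewrite -[X in - (_ * - (X + _))]/(\tr (Q * _)).
rewrite -[X in - (_ * - (_ + X *+ _))]/(\tr (W * _)).
have alg (K : numFieldType) (p q : K) :
    - (2^-1 * - (p + q *+ 4)) = 2^-1 * p + 2 * q by rewrite -mulr_natl; field.
exact: alg.
Qed.

End Point.

Lemma diff_fun_entry (f : V -> C) m c i j :
  (forall v, \forall t \near (0 : C^o), f (m + t *: v) = arrow_mx c (m + t *:
    v) i j) ->
  diff_fun f m = coord_dual R c i j.
Proof.
move=> fE; rewrite /diff_fun /coord_dual; congr linfun; apply/funext => v.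
rewrite derive1E /coord_fun.
have dl := linear_mx_diff m v (arrow_mx_linear c).
have [_ <-] := dl i j.
apply: near_eq_derive; exact: fE.
Qed.

End Correspondence.

Section InducedBivectors.
Variables (R : realType) (n d1 d2 : nat).
Local Notation C := R[i].
Local Notation V := (rep_space R n d1 d2).
Local Notation E := 'M[C]_(d1 + d2).
Local Notation dual := 'Hom(V, C^o).
Local Notation ee := (vertex_idem R d1 d2).
Variables (B : algType C) (e1 e2 : B) (a b : 'I_n -> B).
Variables (T : lmodType C) (tens dbr : B -> B -> T).
Hypothesis tensP : is_bilinear tens.
Hypothesis dbrP : is_double_bracket tens dbr e1 e2.
Hypothesis dbrE : gamma_bracket_values tens dbr e1 e2 a b.
Variable X : V -> B -> E.
Hypothesis XP : forall m, inM m -> is_representation e1 e2 a b m (X m).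
Variable P : V -> dual -> dual -> C.
Hypothesis Pbi : is_bivector P.
Hypothesis Pind : induces_bivector tens dbr X P.

Section AtPoint.
Variables (m : V) (mM : inM m).

Lemma bivectorN al be : P m al be = - P m be al.
Proof. by have [H _] := Pbi mM; apply: H. Qed.

Lemma bivector_linear_l k al be ga :
  P m (k *: al + be) ga = k * P m al ga + P m be ga.
Proof. by have [_ H] := Pbi mM; apply: H. Qed.

Lemma bivector0l ga : P m 0 ga = 0.
Proof.
have := bivector_linear_l (-1) 0 0 ga.
by rewrite scaler0 addr0 mulN1r addNr.
Qed.

Lemma bivector0r al : P m al 0 = 0.
Proof. by rewrite bivectorN bivector0l oppr0. Qed.

Lemma bivector_linear_r k al be ga :
  P m ga (k *: al + be) = k * P m ga al + P m ga be.
Proof.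
rewrite bivectorN bivector_linear_l opprD -mulrN.
by rewrite -!(bivectorN ga).
Qed.

Lemma diff_fun_representation (c : 'I_n + 'I_n) i j :
  diff_fun (fun x => X x (arrow_elt a b c) i j) m = coord_dual R c i j.
Proof.
apply: diff_fun_entry => v; have := near_inM v mM.
by apply: filterS => t tM; rewrite (X_arrow (XP tM)).
Qed.

(** This identifies x as the Hamiltonian vector of a matrix entry. On the spanning covectors,
    [arrow_bracket] with D = E_ji turns the bracket into the variation [ham]. *)
Lemma bivector_coord (c : 'I_n + 'I_n) (i j : 'I_(d1 + d2)) (x : V) :
  let D : E := delta_mx j i in
  let W : E := 2^-1 *: D in
  let Q := W * letter m (arrow_pos c) - letter m (arrow_pos c) * W in
  in_block R c i j ->
  (forall c', arrow_mx c' x = ham (letter m) (arrow_pos c) W Q (arrow_pos c'))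
    ->
  forall al, P m (coord_dual R c i j) al = al x.
Proof.
move=> D W Q ij xham; elim/dual_ind => [|k al be alP beP|c' i' j' _].
- by rewrite bivector0r zero_lfunE.
- by rewrite bivector_linear_r alP beP add_lfunE scale_lfunE.
have Dh : homog ee (~~ odd (arrow_pos c)) (odd (arrow_pos c)) D by [].
have [s [sE sact]] := arrow_bracket tensP dbrP dbrE (XP mM) c' Dh.
have := Pind mM sE i j i' j'; rewrite !diff_fun_representation => ->.
rewrite coord_dualE xham -sact /tens_action summxE; apply: eq_bigr => p _.
by rewrite mul_delta_entry.
Qed.

End AtPoint.

Lemma induced_bivector_corresponds :
  corresponds (@tr_omega_Rep R n d1 d2) P.
Proof.
move=> N be_basis [basis _] m mM v.
elim/dual_ind => [|k al be alP beP|c i j ij].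
- by rewrite bivector0r // zero_lfunE.
- by rewrite bivector_linear_r // alP beP add_lfunE scale_lfunE.
pose D : E := delta_mx j i; pose W : E := 2^-1 *: D.
pose Y := arrow_mx c m; pose Q := W * Y - Y * W.
have scaleAl (k : C) (M M' : E) : k *: M * M' = k *: (M * M').
  by apply: esym; apply: scalemxAl.
have scaleAr (k : C) (M M' : E) : M * (k *: M') = k *: (M * M').
  by apply: esym; apply: scalemxAr.
have Wh : homog ee (~~ odd (arrow_pos c)) (odd (arrow_pos c)) W.
  by rewrite /homog scaleAr scaleAl; congr (_ *: _); apply: ij.
have QE : Q = W * letter m (arrow_pos c) - letter m (arrow_pos c) * W.
  by rewrite letter_pos.
have [x xham] := letters_vector n
  (ham_homog (vertex_idemP R d1 d2) (letter_alternating m) Wh QE).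
have Pc := bivector_coord mM ij (x := x); rewrite -/D -/W -QE in Pc.
(* Antisymmetry puts the tested covector first, so that the left-hand side becomes - omega (v, x)
   for its Hamiltonian vector x. *)
rewrite bivectorN // (Pc xham).
pose om : {linear V -> C^o} := HB.pack (tr_omega_Rep m v : V -> C^o)
  (GRing.isLinear.Build C V C^o _ _ (tr_omega_linear m v)).
have -> : flat (@tr_omega_Rep R n d1 d2) m v x = tr_omega_Rep m v x.
  exact: (lfunE om x).
rewrite (omega_hamiltonian mM v Wh xham) coord_dualE.
rewrite -mxtrace_delta -/D.
pose xi := mu_thetaL m v - mu_thetaR m v.
(* The sum is the fundamental field of [xi], expanded in the basis; it acts on a letter by minus the
   commutator with [lie_mx xi], and this cancels the sign in front of 1/4. *)
have wE : arrow_mx c (v - 4^-1 *: \sum_(k < N)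
      (coord be_basis k (mu_thetaL m v) - coord be_basis k (mu_thetaR m v))
        *: fundamental_field (tnth be_basis k) m) =
    arrow_mx c v + 4^-1 *: (lie_mx xi * Y - Y * lie_mx xi).
  have arrowB (p q : V) (k : C) :
      arrow_mx c (p - k *: q) = arrow_mx c p - k *: arrow_mx c q.
    by rewrite addrC -scaleNr arrow_mx_linear scaleNr addrC.
  have xiE : xi = \sum_(k < N)
      (coord be_basis k (mu_thetaL m v) - coord be_basis k (mu_thetaR m v))
        *: tnth be_basis k.
    rewrite [LHS](coord_basis basis (memvf xi)); apply: eq_bigr => k _.
    by rewrite linearB (tnth_nth 0).
  rewrite arrowB arrow_mx_sum xiE lie_mx_sum; congr (_ + _).
  rewrite mulr_suml mulr_sumr -sumrB -scalerN -sumrN; congr (_ *: _).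
  apply: eq_bigr => k _; rewrite fundamental_arrow scalerN opprK.
  by rewrite scaleAl scaleAr -scalerBr.
have DE : D = 2 *: W by rewrite scalerA divff ?scale1r // pnatr_eq0.
have xiE : lie_mx xi = moment_inv m * dmoment_mx m v - dmoment_mx m v *
  moment_inv m.
  rewrite -lie_thetaL -lie_thetaR /xi -scaleN1r addrC lie_mx_linear.
  by rewrite scaleN1r addrC.
apply: etrans _ (congr2 (fun M M' => \tr (M *m M')) (esym DE) (esym wE)).
apply: etrans _ (tr_commutator_identity W Y (lie_mx xi) (arrow_mx c v)).
by rewrite xiE opprB.
Qed.

End InducedBivectors.

Theorem proposition5p16 (R : realType) (n d1 d2 : nat)
    (n_ge1 : (1 <= n)%N) (d1_ge1 : (1 <= d1)%N) (d2_ge1 : (1 <= d2)%N) :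
  (forall m : rep_space R n d1 d2, inM m ->
     forall u v : rep_space R n d1 d2,
       tr_omega_Rep m u v = boalch_form m u v)
  /\
  (forall (B : algType R[i]) (e1 e2 : B) (a b : 'I_n -> B),
     is_BGamma e1 e2 a b ->
   forall (T : lmodType R[i]) (tens : B -> B -> T),
     is_tensor_square tens ->
   forall dbr : B -> B -> T,
     is_double_bracket tens dbr e1 e2 ->
     gamma_bracket_values tens dbr e1 e2 a b ->
   forall X : rep_space R n d1 d2 -> B -> 'M[R[i]]_(d1 + d2),
     (forall m, inM m -> is_representation e1 e2 a b m (X m)) ->
   forall P : rep_space R n d1 d2 -> 'Hom(rep_space R n d1 d2, R[i]^o) ->
              'Hom(rep_space R n d1 d2, R[i]^o) -> R[i],
     is_bivector P ->
     induces_bivector tens dbr X P ->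
     corresponds (@tr_omega_Rep R n d1 d2) P).
Proof.
split=> [m _ u v|B e1 e2 a b _ T tens [tensP _] dbr dbrP dbrE X XP P Pbi Pind].
  exact: tr_omega_boalch.
exact: (induced_bivector_corresponds tensP dbrP dbrE XP Pbi Pind).
Qed.
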